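(* Let $s$ be a positive integer, and let $A_1,A_2,\ldots,A_s$ be non-empty sets of positive integers (not necessarily disjoint, or even distinct) such that each $A_r$ either is finite or satisfies $\sum_{j\in\mathbb N\setminus A_r}\frac1j<\infty$. Let $d_r:=\sup A_r\in\{1,2,\ldots\}\cup\{\infty\}$ for every $r\in\{1,\ldots,s\}$. Let $(\mathcal A,\varphi)$ be a $*$-probability space and let $(u_r)_{r=1}^s$ be a $*$-free family in $(\mathcal A,\varphi)$ such that each $u_r$ is a $d_r$-Haar unitary. Let $(N_k)_{k=1}^\infty$ be a strictly increasing sequence of positive integers such that $\mathcal S_{N_k}^{(A_r)}\neq\emptyset$ for every $k\geq1$ and every $r\in\{1,\ldots,s\}$. For every positive integer $k$, let $\left(U_r^{(k)}\right)_{r=1}^s$ be an independent family of random $N_k\times N_k$ permutation matrices over a fixed probability space $(\Omega,\mathcal F,P)$ such that each $U_r^{(k)}$ is uniformly distributed over $\mathcal S_{N_k}^{(A_r)}$. Then: (a) $\left(U_r^{(k)}\right)_{r=1}^s$ converges in $*$-distribution to $(u_r)_{r=1}^s$ as $k\to\infty$. (b) If each of the sets $A_1,A_2,\ldots,A_s$ either consists of a single positive integer or is infinite, then $\left(U_r^{(k)}\right)_{r=1}^s$ converges in $*$-distribution almost surely to $(u_r)_{r=1}^s$ as $k\to\infty$.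
   Context: $\mathbb N$ is the set of positive integers. $\mathcal S_N$ is the set of all permutations of $\{1,\ldots,N\}$ and, for a non-empty set $A$ of positive integers, $\mathcal S_N^{(A)}$ is the set of all $\sigma\in\mathcal S_N$ such that the length of every cycle of $\sigma$ (fixed points being cycles of length 1) belongs to $A$. Non-commutative probability. A $*$-probability space is a pair $(\mathcal A,\varphi)$, where $\mathcal A$ is a unital $*$-algebra over $\mathbb C$ and $\varphi:\mathcal A\to\mathbb C$ is a linear functional with $\varphi(1)=1$ and $\varphi(a^*a)\geq0$ for all $a\in\mathcal A$; elements of $\mathcal A$ are called random variables. A family $(\mathcal A_j)_{j\in J}$ of unital subalgebras of $\mathcal A$ is free iff for every $n\geq1$, all $j_1,\ldots,j_n\in J$ with $j_1\neq j_2\neq\cdots\neq j_n$ (consecutive indices distinct), and all $a_i\in\mathcal A_{j_i}$ with $\varphi(a_1)=\cdots=\varphi(a_n)=0$, one has $\varphi(a_1a_2\cdots a_n)=0$. A family $(a_j)_{j\in J}$ in $\mathcal A$ is $*$-free iff the family of the unital $*$-subalgebras $\mathcal A_j$ generated by $a_j$ is free. For a positive integer $d$, a $d$-Haar unitary is a unitary $u\in\mathcal A$ with $u^d=1$ and $\varphi(u^n)=0$ whenever $n$ is not a multiple of $d$. An $\infty$-Haar unitary is a unitary $u\in\mathcal A$ with $\varphi(u^n)=0$ for all integers $n\neq0$. Random matrices. A random $N\times N$ matrix over $(\Omega,\mathcal F,P)$ is a measurable function from $\Omega$ to the set of $N\times N$ complex matrices. For $\sigma\in\mathcal S_N$, $M_\sigma$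 is the $N\times N$ matrix with $(M_\sigma)_{i,j}=1$ if $\sigma(j)=i$ and $0$ otherwise. A random $N\times N$ permutation matrix is a random matrix with values in $\{M_\sigma:\sigma\in\mathcal S_N\}$; it is uniformly distributed over a non-empty $\mathcal S\subseteq\mathcal S_N$ iff its range is $\{M_\sigma:\sigma\in\mathcal S\}$ and each $M_\sigma$, $\sigma\in\mathcal S$, is attained with probability $1/\mathrm{card}\,\mathcal S$. The normalized trace of an $N\times N$ matrix $B$ is $\mathrm{tr}\,B=\frac1N\sum_{i=1}^NB_{ii}$, and $\mathbb E$ is expectation over $(\Omega,\mathcal F,P)$. Convergence. Families $\left(B_r^{(k)}\right)_{r=1}^s$ of random $N_k\times N_k$ matrices converge in $*$-distribution to a family $(b_r)_{r=1}^s$ in $(\mathcal A,\varphi)$ as $k\to\infty$ iff $$\lim_{k\to\infty}\mathbb E\left[\mathrm{tr}\left(B_{r_1}^{(k)}\right)^{\varepsilon_1}\cdots\left(B_{r_n}^{(k)}\right)^{\varepsilon_n}\right]=\varphi\left(b_{r_1}^{\varepsilon_1}\cdots b_{r_n}^{\varepsilon_n}\right)$$ for every $n\geq1$, all $r_1,\ldots,r_n\in\{1,\ldots,s\}$ and all $\varepsilon_1,\ldots,\varepsilon_n\in\{1,*\}$. They converge in $*$-distribution almost surely iff for all such $n,r_i,\varepsilon_i$, $\lim_{k\to\infty}\mathrm{tr}\left(B_{r_1}^{(k)}\right)^{\varepsilon_1}\cdots\left(B_{r_n}^{(k)}\right)^{\varepsilon_n}=\varphi\left(b_{r_1}^{\varepsilon_1}\cdots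 b_{r_n}^{\varepsilon_n}\right)$ almost surely. *)

(* Defs.v *)
(* MathComp-Analysis, over an arbitrary R : realType; C is R[i]. *)
From HB Require Import structures.
From mathcomp Require Export all_boot all_order all_algebra all_fingroup.
From mathcomp Require Export complex spectral.
From mathcomp Require Export all_classical all_reals all_analysis.
Set Implicit Arguments.
Unset Strict Implicit.
Unset Printing Implicit Defensive.
Import Order.TTheory GRing.Theory Num.Theory.
Import numFieldNormedType.Exports.
Local Open Scope classical_set_scope.
Local Open Scope complex_scope.
Local Open Scope sesquilinear_scope.
Local Open Scope ring_scope.

HB.mixin Record isStarAlgebra (R : realType) A of GRing.Algebra R[i] A := {
  star : A -> A ;
  starK : forall a, star (star a) = a ;
  starD : forall a b, star (a + b) = star a + star b ;
  starZ : forall (c : R[i]) a, star (c *: a) = c^* *: star a ;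
  starM : forall a b, star (a * b) = star b * star a
}.

#[short(type="starAlgType")]
HB.structure Definition StarAlgebra (R : realType) :=
  {A of isStarAlgebra R A & GRing.Algebra R[i] A}.

Section StarProbability.
Variables (R : realType) (A : starAlgType R).

(* The order on R[i] makes [0 <= z] mean that z is real and nonnegative. *)
Definition is_state (phi : {scalar A}) : Prop :=
  phi 1 = 1 /\ forall a : A, 0 <= phi (star a * a).

Definition unital_star_subalgebra (B : set A) : Prop :=
  [/\ B 1,
      forall (c : R[i]) a b, B a -> B b -> B (c *: a + b),
      forall a b, B a -> B b -> B (a * b)
    & forall a, B a -> B (star a)].

Definition star_generated (a : A) : set A :=
  smallest unital_star_subalgebra [set a].

Definition free_family (phi : {scalar A}) (J : Type) (B : J -> set A) : Prop :=
  forall (n : nat) (j : 'I_n -> J) (a : 'I_n -> A),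
    (0 < n)%N ->
    (forall i i' : 'I_n, i' = i.+1 :> nat -> j i <> j i') ->
    (forall i, B (j i) (a i)) ->
    (forall i, phi (a i) = 0) ->
    phi (\prod_(i < n) a i) = 0.

Definition star_free (phi : {scalar A}) (J : Type) (a : J -> A) : Prop :=
  free_family phi (fun j => star_generated (a j)).

Definition unitary (u : A) : Prop := star u * u = 1 /\ u * star u = 1.

(* Integer powers of a unitary, whose inverse is its adjoint. *)
Definition unitary_pow (u : A) (n : int) : A :=
  match n with
  | Posz m => u ^+ m
  | Negz m => star u ^+ m.+1
  end.

(* [None] encodes d = oo. *)
Definition haar_unitary (phi : {scalar A}) (d : option nat) (u : A) : Prop :=
  unitary u /\
  match d with
  | Some m =>
      u ^+ m = 1 /\
      forall n : int, ~~ (m%:Z %| n)%Z -> phi (unitary_pow u n) = 0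
  | None => forall n : int, n != 0 -> phi (unitary_pow u n) = 0
  end.

Definition star_if (e : bool) (a : A) : A := if e then star a else a.

End StarProbability.

(* Supremum in {1, 2, ...} U {oo}, with [None] for oo; meant for nonempty A. *)
Definition sup_nat (A : set nat) : option nat :=
  if `[< has_ubound A >] then Some (supremum 0%N A) else None.

(* [porbits sigma] is the set of supports of all the cycles of sigma,
   fixed points included. *)
Definition perms_with_cycles (N : nat) (A : set nat) : {set 'S_N} :=
  [set sigma : 'S_N | [forall c in porbits sigma, #|c| \in A]]%SET.

Section Matrices.
Variables (R : realType) (N : nat).

(* The transpose of the library's [perm_mx sigma]. *)
Definition perm_matrix (sigma : 'S_N) : 'M[R[i]]_N :=
  \matrix_(i, j) (sigma j == i)%:R.

Definition ntr (B : 'M[R[i]]_N) : R[i] := N%:R^-1 * \tr B.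

Definition adj_if (e : bool) (B : 'M[R[i]]_N) : 'M[R[i]]_N :=
  if e then B ^t* else B.

(* N x N complex matrices with their Borel sigma-algebra. *)
Definition borel_mx := g_sigma_algebraType (@open 'M[R[i]^o]_N).

End Matrices.

Section Probability.
Variables (R : realType) (d : measure_display) (T : measurableType d).
Variable P : probability T R.

Definition complex_expectation (X : T -> R[i]) : R[i] :=
  fine 'E_P[fun w => complex.Re (X w)] +i* fine 'E_P[fun w => complex.Im (X w)].

Definition independent_family (I : finType) (d' : measure_display)
    (T' : measurableType d') (X : I -> T -> T') : Prop :=
  forall (J : {set I}) (E : I -> set T'),
    (forall r, measurable (E r)) ->
    P (\bigcap_(r in [set` J]) (X r @^-1` E r)) =
    (\prod_(r in J) P (X r @^-1` E r))%E.

Definition random_matrix (N : nat) (U : T -> borel_mx R N) : Prop :=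
  measurable_fun setT U.

Definition random_perm_matrix (N : nat) (U : T -> borel_mx R N) : Prop :=
  random_matrix U /\ forall w, exists sigma, U w = perm_matrix R sigma.

Definition uniform_on (N : nat) (S : {set 'S_N}) (U : T -> borel_mx R N) :
    Prop :=
  range U = @perm_matrix R N @` [set` S] /\
  forall sigma, sigma \in S ->
    P (U @^-1` [set perm_matrix R sigma]) = (#|S|%:R^-1)%:E.

(* A word in the letters b_1, ..., b_s and their adjoints is given by its
   letters [r] and its exponents [e], where [true] stands for the adjoint. *)
Definition matrix_moment (N s : nat) (B : 'I_s -> 'M[R[i]]_N)
    (n : nat) (r : 'I_n -> 'I_s) (e : 'I_n -> bool) : R[i] :=
  ntr (\prod_(i < n) adj_if (e i) (B (r i))).

Definition star_moment (A : starAlgType R) (phi : {scalar A}) (s : nat)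
    (b : 'I_s -> A) (n : nat) (r : 'I_n -> 'I_s) (e : 'I_n -> bool) : R[i] :=
  phi (\prod_(i < n) star_if (e i) (b (r i))).

Definition cvg_star_distribution (N : nat -> nat) (s : nat)
    (B : forall k, 'I_s -> T -> borel_mx R (N k))
    (A : starAlgType R) (phi : {scalar A}) (b : 'I_s -> A) : Prop :=
  forall (n : nat) (r : 'I_n -> 'I_s) (e : 'I_n -> bool), (0 < n)%N ->
    complex_expectation (fun w => matrix_moment (fun q => B k q w) r e)
      @[k --> \oo] --> (star_moment phi b r e : R[i]^o).

Definition cvg_star_distribution_as (N : nat -> nat) (s : nat)
    (B : forall k, 'I_s -> T -> borel_mx R (N k))
    (A : starAlgType R) (phi : {scalar A}) (b : 'I_s -> A) : Prop :=
  forall (n : nat) (r : 'I_n -> 'I_s) (e : 'I_n -> bool), (0 < n)%N ->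
    {ae P, forall w, matrix_moment (fun q => B k q w) r e
      @[k --> \oo] --> (star_moment phi b r e : R[i]^o)}.

End Probability.

(* Main.v *)
Require Import Defs.
From mathcomp Require Import zify ring lra measurable_realfun.
Set Implicit Arguments.
Unset Strict Implicit.
Unset Printing Implicit Defensive.
Import Order.TTheory GRing.Theory Num.Theory.
Import numFieldNormedType.Exports.

(** The normalized trace of a word in permutation matrices is the proportion of
    points fixed by the corresponding permutation.  The theorem thus says that
    a word in the random permutations fixes few points, or moves few points if
    it is trivial in the free product of the cyclic groups Z/d_r (Z if d_r is
    infinite).

    Words.  Each law is invariant under conjugation, so averages do not change
    when every permutation is conjugated by its own uniform permutation.  A
    fixed point of an alternating product of powers s_r^n is a closed walk
    whose steps apply the successive factors.  A walk in which some step is a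
    loop is determined by a fixed point of the power applied there, which gives
    [nfix_prod]: up to the fixed points of the factors, only the loopless
    walks count.  Their number has a second moment bounded in N
    ([sum_card_walks], [sum_loopless_sqr]).  Indeed, let E be the number of
    pairs (colour r, point visited by a step of colour r).  Prescribing a
    uniform permutation at p points has probability of order N^-p.  The walk
    imposes relations on the images of the E pairs under the conjugating
    permutations; as no step is a loop, the graph of these relations has no
    isolated vertex, so at most E/2 of the pairs dominate it and determine the
    other images: the relations hold with probability O(N^(E/2 - E)).  Since
    consecutive steps have distinct colours, every visited point belongs to
    two pairs, whence at most N^(E/2) walks of a given shape, and the powers of
    N cancel.

    Powers of one permutation.  Let d be the supremum of the set A of allowed
    cycle lengths.  One has to see that s^n fixes few points when d does not
    divide n and moves few points when it does.  Let a_n be the probability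
    that a uniform permutation of n points has all its cycle lengths in A; its
    generating function is exp (sum of z^j / j over j in A).  Removing the cycle
    of a point shows that the mean number of points on j-cycles is
    a_(N-j) / a_N ([sum_porbit_size]).  If A is finite, this is o(N) for j < d
    ([cycle_weight_finite]), so almost all points lie on d-cycles.  If the
    reciprocals of the integers outside A are summable, a_n is bounded below
    ([cycle_weight_lower]); the law is then dominated by the uniform one, for
    which the second moment of the number of fixed points of s^n is bounded, by
    the same count of walks ([sum_nfix_expg]).

    Conclusion.  Cancelling trivial powers and merging neighbours brings any
    word to an alternating one without trivial power ([word_reduction]), at the
    cost of few points; rotating such a word makes it cyclically alternating or
    shorter ([reduced_small]).  On the algebraic side phi is 1 on the empty word
    and 0 on the others, by freeness.  All estimates bound the mean square of a
    proportion of points: it tends to 0 in general, which gives convergence in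
    expectation, and it is O(1 / N^2) when each A_r is infinite or a singleton.
    As N_k > k, the mean squares are then summable, so the series of
    the squared proportions converges almost surely.  Both cases are treated at
    once by leaving abstract the class [small] of admissible error sequences. *)

(** * Permutations with prescribed values *)

Section PermutationCounting.
Import mathcomp.boot.fintype mathcomp.boot.finset.

(** Two permutations that agree with f on Y differ by a permutation supported
    outside Y. *)
Lemma card_perm_agree (T : finType) (Y : {set T}) (f : T -> T) :
  #|[set t : {perm T} | [forall p in Y, t p == f p]]| <= (#|T| - #|Y|)`!.
Proof.
set X := [set _ | _].
case: (set_0Vmem X) => [->|[t0]]; first by rewrite cards0.
rewrite inE => /forall_inP t0P.
have <- : #|~: Y| = #|T| - #|Y| by rewrite cardsCs setCK.
rewrite -card_perm -[#|X|](card_imset _ (mulIg t0^-1%g)).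
apply/subset_leq_card/subsetP => s /imsetP[t]; rewrite inE => /forall_inP tP ->.
apply/subsetP => p; rewrite !inE permM => tp; apply: contra tp => pY.
by rewrite (eqP (tP _ pY)) -(eqP (t0P _ pY)) permK.
Qed.

Lemma exp_le_ffact N v : v <= N -> N ^ v <= v ^ v * N ^_ v.
Proof.
move=> vN; rewrite ffact_prod.
rewrite -[X in N ^ X]card_ord -[X in _ ^ X * _]card_ord -!prod_nat_const -big_split /=.
by apply: leq_prod => i _; have := ltn_ord i; nia.
Qed.

(** The form in which the falling factorial is compared with a power: up to a
    constant, v prescribed values have probability at most N^-v. *)
Lemma fact_sub_le N v E : v <= N -> v <= E -> (N - v)`! * N ^ v <= E ^ E * N`!.
Proof.
move=> vN vE; rewrite -(ffact_fact vN) mulnC mulnA leq_mul2r.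
apply/orP; right; apply: leq_trans (exp_le_ffact vN) _; rewrite leq_mul2r.
apply/orP; right; case: v {vN} vE => [|v] vE; first by rewrite expn_gt0; case: E vE.
by apply: (@leq_trans (E ^ v.+1)); rewrite ?leq_exp2r ?leq_pexp2l //; case: E vE.
Qed.

Lemma double_count (aT bT : finType) (r : aT -> bT -> bool) :
  \sum_a #|[set b | r a b]| = \sum_b #|[set a | r a b]|.
Proof.
have E (cT dT : finType) (q : cT -> dT -> bool) :
    \sum_a #|[set b | q a b]| = \sum_a \sum_b q a b.
  apply: eq_bigr => a _; rewrite -sum1_card big_mkcond /=.
  by apply: eq_bigr => b _; rewrite inE; case: (q a b).
by rewrite !E exchange_big.
Qed.

Lemma card_fibers (aT rT : finType) (f : aT -> rT) (X : {set aT}) (C : {pred rT}) w D :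
  (forall x, x \in X -> f x \in C) ->
  (forall c, #|[set x in X | f x == c]| * w <= D) -> #|X| * w <= #|C| * D.
Proof.
move=> fC fib; rewrite -sum1_card (partition_big f (mem C)) //=.
rewrite big_distrl /= -sum_nat_const; apply: leq_sum => c _; apply: leq_trans (fib c).
by rewrite -sum1_card leq_mul2r; apply/orP; right; apply: eq_leq; apply: eq_bigl => x; rewrite inE.
Qed.

(** Ore's bound on the domination number: the complement of a minimal
    dominating set is dominating, since otherwise some vertex of the minimal
    set would have all its neighbours, at least one, inside that set and could
    be dropped.  The smaller of the two sets has at most half the vertices. *)
Lemma half_dominating (T : finType) (V : {set T}) (e : rel T) : symmetric e ->
  (forall v, v \in V -> exists2 w, w \in V & (w != v) && e v w) ->
  exists R : {set T}, [/\ R \subset V, #|R|.*2 <= #|V| &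
     forall v, v \in V -> v \notin R -> exists2 w, w \in R & e v w].
Proof.
move=> e_sym noiso.
pose dom (R : {set T}) :=
  (R \subset V) && [forall v in V, (v \in R) || [exists w in R, e v w]].
have domV : dom V.
  by apply/andP; split=> //; apply/forall_inP => v ->.
have [R /minsetP[/andP[RV /forall_inP Rdom] Rmin] _] := minset_exists domV.
have domS (S : {set T}) : S \subset V -> dom S ->
    forall v, v \in V -> v \notin S -> exists2 w, w \in S & e v w.
  move=> _ /andP[_ /forall_inP Sd] v vV vS.
  by have := Sd v vV; rewrite (negPf vS) => /exists_inP.
have domD : dom (V :\: R).
  apply/andP; split; first exact: subsetDl.
  apply/forall_inP => v vV; rewrite inE vV andbT.
  case: (boolP (v \in R)) => //= vR; apply: contraT => /exists_inPn noD.
  have inR w : w \in V -> e v w -> w \in R.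
    move=> wV evw; apply: contraT => wR.
    by have := noD w; rewrite inE wR wV evw => /(_ isT).
  suff /Rmin : dom (R :\ v) by move=> /(_ (subD1set _ _)) ER; move: vR; rewrite -ER !inE eqxx.
  apply/andP; split; first exact: subset_trans (subD1set _ _) RV.
  apply/forall_inP => u uV; rewrite !inE.
  case: eqVneq => [->|uv] /=.
    have [w wV /andP[wv evw]] := noiso v vV.
    by apply/exists_inP; exists w => //; rewrite !inE wv inR.
  case: (boolP (u \in R)) => //= uR.
  have := Rdom u uV; rewrite (negPf uR) => /exists_inP[w wR euw].
  apply/exists_inP; exists w => //; rewrite !inE wR andbT.
  by apply: contra uR => /eqP wv; apply: inR => //; rewrite e_sym -wv.
have cV : #|R| + #|V :\: R| = #|V|.
  by rewrite -(cardsID R V) (setIidPr RV).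
case: (leqP #|R| #|V :\: R|) => cR.
  exists R; split=> //; first by rewrite -addnn -cV leq_add2l.
  by apply: domS => //; apply/andP; split=> //; apply/forall_inP.
exists (V :\: R); split; first exact: subsetDl.
  by rewrite -addnn -cV leq_add2r ltnW.
by apply: domS => //; exact: subsetDl.
Qed.

Lemma card_perm_family_agree (K T : finType) (V : {set K * T}) (f : K -> T -> T) E :
  #|V| <= E ->
  #|[set t : {ffun K -> {perm T}} | [forall p in V, t p.1 p.2 == f p.1 p.2]]|
    * #|T| ^ #|V| <= (E ^ E * #|T| `!) ^ #|K|.
Proof.
move=> VE; pose Y r := [set p | (r, p) \in V].
have cardV : #|V| = \sum_r #|Y r|.
  under eq_bigr do rewrite -sum1_card.
  rewrite (pair_big_dep xpredT (fun r p => p \in Y r)) -sum1_card /=.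
  by apply: eq_bigl => -[r p]; rewrite /= inE.
pose F r := [set t : {perm T} | [forall p in Y r, t p == f r p]].
have -> : #|[set t : {ffun K -> {perm T}} | [forall p in V, t p.1 p.2 == f p.1 p.2]]|
    = \prod_r #|F r|.
  transitivity #|family F|; last by rewrite card_family foldrE big_map big_enum.
  apply: eq_card => t; rewrite inE.
  apply/forall_inP/familyP => [H r|H [r p] rp] /=.
    by rewrite inE; apply/forall_inP => p; rewrite inE => /H.
  by have := H r; rewrite inE => /forall_inP; apply; rewrite inE.
rewrite cardV expn_sum -big_split /= -prod_nat_const.
apply: leq_prod => r _; have YrE : #|Y r| <= E.
  by apply: leq_trans VE; rewrite cardV (bigD1 r) //= leq_addr.
apply: leq_trans (fact_sub_le (max_card _) YrE).
by rewrite leq_mul2r card_perm_agree orbT.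
Qed.

(** A sum over functions in which y weighs N^-q, q being the size of its image,
    is bounded independently of N: the functions with a given kernel are at
    most N^q. *)
Lemma sum_by_image (I T : finType) (x0 : T) (W : {ffun I -> T} -> nat) D :
  (forall y, W y * #|T| ^ #|y @: I| <= D) -> \sum_y W y <= #|I| ^ #|I| * D.
Proof.
move=> WD.
(* k y records the kernel of y by a choice of representatives. *)
pose k (y : {ffun I -> T}) := [ffun i => odflt i [pick j | y j == y i]].
have yk (y : {ffun I -> T}) i : y (k y i) = y i.
  by rewrite ffunE; case: pickP => [j /eqP|].
have kk (y : {ffun I -> T}) i j : y i = y j -> k y i = k y j.
  move=> yij; rewrite !ffunE (@eq_pick _ _ (fun l => y l == y j)); last by move=> l; rewrite yij.
  by case: pickP => // /(_ j); rewrite eqxx.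
have imk (y : {ffun I -> T}) : #|k y @: I| = #|y @: I|.
  rewrite -(@card_in_imset _ _ y (k y @: I)).
    apply: eq_card => p; apply/imsetP/imsetP => [[_ /imsetP[i _ ->] ->]|[i _ ->]].
      by exists i => //; rewrite yk.
    by exists (k y i); rewrite ?yk ?imset_f.
  by move=> _ _ /imsetP[i _ ->] /imsetP[j _ ->]; rewrite !yk => /kk.
rewrite (partition_big k xpredT) //= -card_ffun -sum_nat_const; apply: leq_sum => h _.
have N0 : 0 < #|T| by apply/card_gt0P; exists x0.
rewrite -(leq_pmul2r (_ : 0 < #|T| ^ #|h @: I|)) ?expn_gt0 ?N0 // big_distrl /=.
apply: (@leq_trans (\sum_(y | k y == h) D)).
  by apply: leq_sum => y /eqP <-; rewrite imk.
rewrite sum_nat_const mulnC leq_mul2l; apply/orP; right.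
apply: leq_trans (_ : _ <= #|pffun_on x0 (mem (h @: I)) (@predT T)|) _; last first.
  by rewrite card_pffun_on.
pose res (y : {ffun I -> T}) := [ffun i => if i \in h @: I then y i else x0].
rewrite -(@card_in_imset _ _ res).
  apply/subset_leq_card/subsetP => _ /imsetP[y _ ->]; apply/pffun_onP; split=> //.
  by apply/supportP => i /negPf ih; rewrite ffunE ih.
move=> y y' yP y'P /ffunP eyy.
have ky : k y = h by apply/eqP; exact: yP.
have ky' : k y' = h by apply/eqP; exact: y'P.
 apply/ffunP => i.
have hy : y (h i) = y i by rewrite -ky yk.
have hy' : y' (h i) = y' i by rewrite -ky' yk.
by have := eyy (h i); rewrite !ffunE imset_f // hy hy'.
Qed.

(** * Closed walks without loops *)

Section ClosedWalks.
Variables (I K T : finType) (x0 : T) (nxt prv : I -> I) (c : I -> K) (g : I -> {perm T}).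
Hypothesis nxtK : forall i, nxt (prv i) = i.
Hypothesis c_nxt : forall i, c (nxt i) != c i.

(** The orbits of nxt are the cycles along which the walk y closes up.  Step i
    applies to y i the conjugate of g i by t (c i), written without inverses
    as a relation between images under t (c i). *)
Definition walk_in (t : {ffun K -> {perm T}}) (y : {ffun I -> T}) :=
  [forall i, (y (nxt i) != y i) && (t (c i) (y (nxt i)) == g i (t (c i) (y i)))].

(** The heart of the estimate: for a fixed loopless y, the relations between
    the images under t link the pairs (colour, point) in V into a graph without
    isolated vertices, so the images on a dominating half of V determine all of
    them; and y takes at most |V| / 2 values because each of them is met in the
    two colours of consecutive steps. *)
Lemma card_walk_frames (y : {ffun I -> T}) :
  #|[set t | walk_in t y]| * #|T| ^ #|y @: I|
    <= ((#|I|.*2) ^ (#|I|.*2) * #|T| `!) ^ #|K|.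
Proof.
case: (set_0Vmem [set t | walk_in t y]) => [->|[t1]]; first by rewrite cards0.
rewrite inE => /forallP t1P.
have noloop i : y (nxt i) != y i by have /andP[] := t1P i.
pose src i := (c i, y i); pose tgt i := (c i, y (nxt i)).
pose V := src @: I :|: tgt @: I.
have srcV i : src i \in V by rewrite inE imset_f.
have tgtV i : tgt i \in V by rewrite inE imset_f ?orbT.
pose e (p q : K * T) := [exists i, (p == src i) && (q == tgt i) || (p == tgt i) && (q == src i)].
have e_sym : symmetric e.
  by move=> p q; apply: eq_existsb => i; rewrite orbC [X in X || _]andbC [X in _ || X]andbC.
have noiso v : v \in V -> exists2 w, w \in V & (w != v) && e v w.
  case/setUP => /imsetP[i _ ->].
    exists (tgt i) => //; rewrite xpair_eqE eqxx noloop /=.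
    by apply/existsP; exists i; rewrite !eqxx.
  exists (src i) => //; rewrite xpair_eqE eqxx eq_sym noloop /=.
  by apply/existsP; exists i; rewrite !eqxx orbT.
have [R [RV RV2 Rdom]] := half_dominating e_sym noiso.
have VE : #|V| <= #|I|.*2.
  by apply: leq_trans (leq_card_setU _ _) _; rewrite -addnn leq_add ?leq_imset_card.
have imV : #|y @: I|.*2 <= #|V|.
  have -> : #|V| = \sum_p #|[set r | (r, p) \in V]|.
    under eq_bigr do rewrite -sum1_card.
    rewrite (pair_big_dep xpredT (fun p r => r \in [set r | (r, p) \in V])) -sum1_card /=.
    rewrite (reindex (fun q : T * K => (q.2, q.1))) /=; last first.
      by exists (fun q : K * T => (q.2, q.1)) => -[].
    by apply: eq_bigl => -[p r]; rewrite /= inE.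
  rewrite -muln2 -sum_nat_const big_mkcond /=; apply: leq_sum => p _.
  case: ifP => // /imsetP[i _ ->].
  have <- : #|[set c i; c (prv i)]| = 2 by rewrite cards2 -{1}(nxtK i) c_nxt.
  apply/subset_leq_card/subsetP => r; rewrite !inE => /orP[] /eqP ->; apply/orP.
    by left; apply: imset_f.
  by right; apply/imsetP; exists (prv i); rewrite // /tgt nxtK.
set X := [set t | _]; set Q := _ @: I in imV *; set D := _ ^ #|K|.
pose code (t : {ffun K -> {perm T}}) :=
  [ffun p : K * T => if p \in R then t p.1 p.2 else x0].
have XV : #|X| * #|T| ^ #|V| <= #|T| ^ #|R| * D.
  have <- : #|pffun_on x0 (mem R) (@predT T)| = #|T| ^ #|R| by rewrite card_pffun_on.
  apply: (@card_fibers _ _ code) => [t _|h].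
    apply/pffun_onP; split=> //.
    by apply/supportP => p /negPf pR; rewrite ffunE pR.
  case: (set_0Vmem [set t in X | code t == h]) => [->|[t0]]; first by rewrite cards0.
  rewrite !inE => /andP[t0X /eqP t0h].
  apply: leq_trans (card_perm_family_agree (fun r => t0 r) VE).
  rewrite leq_mul2r; apply/orP; right.
  apply/subset_leq_card/subsetP => t; rewrite !inE => /andP[tX /eqP th].
  have tR p : p \in R -> t p.1 p.2 = t0 p.1 p.2.
    by move=> pR; have := congr1 (fun h : {ffun K * T -> T} => h p) (etrans th (esym t0h));
       rewrite !ffunE pR.
  apply/forall_inP => p pV; apply/eqP; case: (boolP (p \in R)) => pR; first exact: tR.
  have [w wR] := Rdom p pV pR; move/existsP => -[i']; move/tR: wR.
  have /andP[_ /eqP ti] := forallP tX i'; have /andP[_ /eqP t0i] := forallP t0X i'.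
  case: w => w1 w2; case: p {pV pR} => p1 p2 /= tw.
  rewrite !xpair_eqE => /orP[] /andP[/andP[/eqP E1 /eqP E2] /andP[/eqP E3 /eqP E4]]; subst.
    by move: tw; rewrite ti t0i => /perm_inj.
  by rewrite ti t0i tw.
have N0 : 0 < #|T| by apply/card_gt0P; exists x0.
rewrite -(leq_pmul2l (_ : 0 < #|T| ^ #|R|)) ?expn_gt0 ?N0 //.
apply: leq_trans XV; rewrite mulnCA leq_mul2l -expnD; apply/orP; right.
by apply: leq_pexp2l => //; move: RV2 imV; rewrite -!addnn; lia.
Qed.

Lemma sum_card_walks :
  \sum_(t : {ffun K -> {perm T}}) #|[set y | walk_in t y]|
    <= #|I| ^ #|I| * ((#|I|.*2) ^ (#|I|.*2) * #|T| `!) ^ #|K|.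
Proof.
rewrite (double_count walk_in).
by apply: (sum_by_image x0) => y; exact: card_walk_frames.
Qed.
End ClosedWalks.

(** The same count for one uniform permutation t and walks whose steps all apply
    t.  Here the sources of the steps are exactly the values of y, so loops are
    harmless. *)
Lemma sum_card_cycles (I T : finType) (x0 : T) (nxt : I -> I) :
  \sum_(t : {perm T}) #|[set y : {ffun I -> T} | [forall i, y (nxt i) == t (y i)]]|
    <= #|I| ^ #|I| * (#|I| ^ #|I| * #|T| `!).
Proof.
rewrite (double_count (fun (t : {perm T}) (y : {ffun I -> T}) => [forall i, y (nxt i) == t (y i)])).
apply: (sum_by_image x0) => y.
apply: leq_trans (fact_sub_le (max_card _) (leq_imset_card y I)).
rewrite leq_mul2r; apply/orP; right.
set X := [set t | _]; case: (set_0Vmem X) => [->|[t0]]; first by rewrite cards0.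
rewrite inE => /forallP t0P; apply: leq_trans (card_perm_agree _ t0).
apply/subset_leq_card/subsetP => t; rewrite !inE => /forallP tP.
apply/forall_inP => _ /imsetP[i _ ->].
by rewrite -(eqP (tP i)) -(eqP (t0P i)).
Qed.

End PermutationCounting.

(** * Removing a cycle from a permutation *)

Section CyclePerms.
Import mathcomp.boot.fintype mathcomp.boot.finset.
Variable T : finType.
Implicit Types (S C D : {set T}) (s t k : {perm T}) (x y : T) (A : pred nat).

Definition cycle_perms S A : {set {perm T}} :=
  [set s | perm_on S s && [forall x in S, A #|porbit s x|]].

Lemma porbit_agree D s t x :
  (forall y, y \in D -> (t y = s y) /\ s y \in D) -> x \in D -> porbit t x = porbit s x.
Proof.
move=> st xD.
have it i : (t ^+ i)%g x = (s ^+ i)%g x /\ (s ^+ i)%g x \in D.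
  elim: i => [|i [IH1 IH2]]; first by rewrite !expg0 perm1.
  by rewrite !expgSr !permM IH1; have [-> ->] := st _ IH2.
apply/setP => y; apply/porbitP/porbitP => -[i ->]; exists i.
  by have [] := it i.
by have [->] := it i.
Qed.

Lemma perm_on_porbit s x S : perm_on S s -> x \in S -> porbit s x \subset S.
Proof.
move=> sS xS; apply/subsetP => y /porbitP[i ->].
by elim: i => [|i IH]; rewrite ?expg0 ?perm1 // expgSr permM perm_closed.
Qed.

Definition full_cycles C x : {set {perm T}} := [set k | perm_on C k && (porbit k x == C)].

(** A permutation of S for which C is the cycle of x is the product of a
    full cycle on C and a permutation of S minus C. *)
Lemma card_cycle_perms_porbit S A C x : C \subset S -> x \in C ->
  #|[set s in cycle_perms S A | porbit s x == C]| =
  A #|C| * (#|full_cycles C x| * #|cycle_perms (S :\: C) A|).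
Proof.
move=> CS xC; rewrite -cardsX.
have onC k s y : perm_on (S :\: C) s -> perm_on C k -> y \in C -> (k * s)%g y = k y.
  move=> sSC kC yC; rewrite permM (out_perm sSC) // inE negb_and negbK.
  by rewrite (perm_closed y kC) yC.
have offC k s y : perm_on C k -> y \notin C -> (k * s)%g y = s y.
  by move=> kC yC; rewrite permM (out_perm kC).
have AP s y : s \in cycle_perms S A -> y \in S -> A #|porbit s y|.
  by rewrite inE => /andP[_ /forall_inP]; apply.
case: (boolP (A #|C|)) => AC; last first.
  rewrite mul0n; apply: eq_card0 => s; rewrite inE; apply: contraNF AC.
  by move=> /andP[sA /eqP <-]; apply: (AP _ _ sA); apply: (subsetP CS).
rewrite mul1n -(@card_in_imset _ _ (fun p => p.1 * p.2)%g); last first.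
  move=> [k s] [k' s']; rewrite !inE /= => /andP[/andP[kC _] /andP[sS _]].
  move=> /andP[/andP[kC' _] /andP[sS' _]] E.
  have Ek : k = k'.
    apply/permP => y; case: (boolP (y \in C)) => yC; last by rewrite !(out_perm _ yC).
    by rewrite -(onC k s) // E onC.
  by rewrite -Ek in E *; move/mulgI: E => ->.
apply: eq_card => s; rewrite [LHS]inE; apply/andP/imsetP; last first.
  case=> -[k s']; rewrite !inE /= => /andP[/andP[kC /eqP kx] /andP[sS /forall_inP sA]] ->.
  have orbC y : y \in C -> porbit (k * s')%g y = C.
    move=> yC; rewrite (@porbit_agree C k) //.
      by rewrite -[RHS]kx; apply/eqP; rewrite eq_porbit_mem kx.
    by move=> z zC; rewrite onC // perm_closed.
  split; last by rewrite orbC.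
  apply/andP; split.
    apply: perm_onM; [exact: subset_trans kC CS | exact: subset_trans sS (subsetDl _ _)].
  apply/forall_inP => y yS; case: (boolP (y \in C)) => yC; first by rewrite orbC.
  have yD : y \in S :\: C by rewrite inE yC.
  rewrite (@porbit_agree (S :\: C) s') ?sA //.
  by move=> z zD; rewrite perm_closed // offC //; case/setDP: zD.
case=> sA /eqP sx; have /andP[sS _] : perm_on S s && [forall x in S, A #|porbit s x|].
  by move: sA; rewrite inE.
have sC y : (s y \in C) = (y \in C).
  by rewrite -sx -!eq_porbit_mem; have := porbit_perm s 1 y; rewrite expg1 => ->.
have sN : s \in 'N(C | 'P)%g.
  by rewrite !inE /=; apply/subsetP => y yC; rewrite inE /= /aperm sC.
pose k := restr_perm C s.
have kE y : y \in C -> k y = s y by move=> yC; rewrite /k restr_permE.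
have kC : perm_on C k := restr_perm_on C s.
have kV y : y \in C -> (k^-1 * s)%g y = y.
  move=> yC; have yC' : (k^-1)%g y \in C by rewrite perm_closed // perm_onV.
  by rewrite permM -kE // permKV.
have offk y : y \notin C -> (k^-1 * s)%g y = s y.
  by move=> yC; rewrite permM (out_perm (perm_onV kC)).
exists (k, (k^-1 * s)%g); last by rewrite /= mulKVg.
rewrite !inE /= kC /=; apply/andP; split; last (apply/andP; split).
- rewrite -[X in _ == X]sx; apply/eqP; apply: (@porbit_agree C) => // y yC.
  by rewrite kE // sC.
- apply/subsetP => y; rewrite !inE => ny; apply/andP; split.
    by apply: contra ny => yC; rewrite kV.
  apply: contraNT ny => yS; rewrite offk; last by apply: contra yS; apply: (subsetP CS).
  by rewrite (out_perm sS).
- apply/forall_inP => y /setDP[yS yC]; rewrite (@porbit_agree (S :\: C) s) ?AP //.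
    by move=> z /setDP[zS zC]; rewrite offk // inE sC zC perm_closed.
  by rewrite inE yC.
Qed.

Lemma sum_supsets S x (F : nat -> nat) : x \in S ->
  \sum_(C : {set T} | (x \in C) && (C \subset S)) F #|C| =
  \sum_(j < #|S|) 'C(#|S|.-1, j) * F j.+1.
Proof.
move=> xS.
rewrite (reindex_onto (fun D => x |: D) (fun C => C :\ x)) /=; last first.
  by move=> C /andP[xC _]; rewrite setD1K.
rewrite (eq_bigl (fun D => D \subset S :\ x)); last first.
  move=> D; rewrite setU11 /= subUset sub1set xS /= subsetD1.
  case: (boolP (x \in D)) => xD; last by rewrite setU1K ?eqxx.
  rewrite andbF; apply/andP => -[_ /eqP E]; move: xD; rewrite -E !inE eqxx //.
rewrite (eq_bigr (fun D : {set T} => F #|D|.+1)); last first.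
  by move=> D; rewrite subsetD1 => /andP[_ xD]; rewrite cardsU1 xD.
have -> : #|S| = #|S :\ x|.+1 by rewrite (cardsD1 x S) xS.
move: (S :\ x) => B; rewrite /=.
rewrite (partition_big (fun D : {set T} => inord #|D| : 'I_#|B|.+1) xpredT) //=.
apply: eq_bigr => j _; rewrite -(cards_draws B) -sum_nat_const; apply: eq_big.
  move=> D; rewrite inE; case: (boolP (D \subset B)) => //= DB.
  by rewrite -val_eqE /= inordK // ltnS subset_leq_card.
by move=> D /andP[DB /eqP <-]; rewrite inordK // ltnS; exact: subset_leq_card.
Qed.

(** Instead of enumerating cycles, apply the preceding decomposition to all |C|!
    permutations of C: by induction, the possible cycles of x with a given
    number of elements, less than |C|, together account for (|C| - 1)! of
    them. *)
Lemma card_full_cycles C x : x \in C -> #|full_cycles C x| = (#|C|.-1)`!.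
Proof.
elim: {C}_.+1 {-2}C (ltnSn #|C|) => // n IH C; rewrite ltnS => Cn xC.
have decomp S : x \in S -> #|cycle_perms S predT| =
    \sum_(D : {set T} | (x \in D) && (D \subset S))
       #|full_cycles D x| * #|cycle_perms (S :\: D) predT|.
  move=> xS; rewrite -sum1_card (partition_big (fun s => porbit s x)
     (fun D : {set T} => (x \in D) && (D \subset S))) /=; last first.
    move=> s; rewrite inE => /andP[sS _].
    by rewrite porbit_id perm_on_porbit.
  apply: eq_bigr => D /andP[xD DS].
  rewrite -[RHS]mul1n -(card_cycle_perms_porbit predT DS xD) -sum1_card.
  by apply: eq_bigl => s; rewrite [RHS]inE.
have cardT S : #|cycle_perms S predT| = #|S| `!.
  rewrite -card_perm; apply: eq_card => s; rewrite !inE.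
  by rewrite [X in _ && X](_ : _ = true) ?andbT //; apply/forall_inP.
have := decomp C xC; rewrite cardT (bigD1 C) ?xC ?subxx //= setDv cardT cards0 muln1.
rewrite (eq_bigr (fun D : {set T} => (#|D|.-1)`! * (#|C| - #|D|)`!)); last first.
  move=> D /andP[/andP[xD DC] neD]; rewrite cardT cardsD (setIidPr DC) IH //.
  by apply: leq_trans Cn; apply: proper_card; rewrite properEneq neD.
have := @sum_supsets C x (fun m => m.-1`! * (#|C| - m)`!) xC.
rewrite (bigD1 C) ?xC ?subxx //= subnn fact0 muln1.
have -> : #|C| = #|C :\ x|.+1 by rewrite (cardsD1 x C) xC.
move: (#|C :\ x|) => m /=.
rewrite [X in _ = X -> _](eq_bigr (fun _ => m`!)); last first.
  by move=> j _; rewrite subSS bin_fact // -ltnS.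
rewrite sum_nat_const card_ord factS => E1 E2.
by move: E2; rewrite -E1 => /eqP; rewrite eqn_add2r => /eqP.
Qed.

End CyclePerms.

Local Open Scope ring_scope.

(** * Exponential generating functions *)

Section Convolution.
Variable R : realType.
Implicit Types u v w g : nat -> R.

Definition conv u v n : R := \sum_(i < n.+1) u i * v (n - i)%N.

(** Truncated polynomials carry the algebraic laws of the product over to
    convolutions. *)
Lemma coef_conv u v n m : (m <= n)%N ->
  ((\poly_(i < n.+1) u i) * (\poly_(i < n.+1) v i))`_m = conv u v m.
Proof.
move=> mn; rewrite coefM; apply: eq_bigr => i _.
by rewrite !coef_poly !ltnS (leq_trans (leq_subr _ _) mn) (leq_trans _ mn) // -ltnS.
Qed.

Lemma eq_conv u u' v v' n : (forall i, (i <= n)%N -> u i = u' i) ->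
  (forall i, (i <= n)%N -> v i = v' i) -> conv u v n = conv u' v' n.
Proof.
by move=> uu vv; apply: eq_bigr => i _; rewrite uu ?vv ?leq_subr // -ltnS.
Qed.

Lemma convC u v : conv u v =1 conv v u.
Proof. by move=> n; rewrite -(coef_conv u v (leqnn n)) mulrC coef_conv. Qed.

Lemma convA u v w : conv u (conv v w) =1 conv (conv u v) w.
Proof.
move=> n; pose P f := \poly_(i < n.+1) (f i : R).
have PM f g i : (i <= n)%N -> (P f * P g)`_i = (P (conv f g))`_i.
  by move=> ni; rewrite coef_conv // coef_poly ltnS ni.
rewrite -(coef_conv u _ (leqnn n)) -(coef_conv _ w (leqnn n)) -!/(P _).
transitivity ((P u * (P v * P w))`_n).
  rewrite [RHS]coefM coefM; apply: eq_bigr => i _; rewrite PM //; exact: leq_subr.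
rewrite mulrA !coefM; apply: eq_bigr => i _; rewrite PM // -ltnS //.
Qed.

Lemma convDl u v w n : conv (fun i => u i + v i) w n = conv u w n + conv v w n.
Proof. by rewrite -big_split; apply: eq_bigr => i _; rewrite mulrDl. Qed.

Lemma convDr u v w n : conv w (fun i => u i + v i) n = conv w u n + conv w v n.
Proof. by rewrite convC convDl !(convC w). Qed.

Lemma deriv_conv u v n :
  n%:R * conv u v n = conv (fun i => i%:R * u i) v n + conv u (fun i => i%:R * v i) n.
Proof.
rewrite -big_split mulr_sumr; apply: eq_bigr => i _ /=.
have {1}-> : n = (i + (n - i))%N by rewrite subnKC // -ltnS.
by rewrite natrD; ring.
Qed.

(** Coefficients of exp (sum over j > 0 of g j z^j / j), computed from the
    differential equation z f' = f (sum of g j z^j), which reads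
    n f_n = sum over i < n of f_i g (n - i).  The first argument is fuel. *)
Fixpoint exp_coef_rec g (k n : nat) : R :=
  if k is k'.+1 then
    if n is n'.+1 then (n'.+1)%:R^-1 * \sum_(i < n) exp_coef_rec g k' i * g (n - i)%N else 1
  else 0.

Definition exp_coef g n := exp_coef_rec g n.+1 n.

Lemma exp_coef_recE g k l n : (n < k)%N -> (n < l)%N -> exp_coef_rec g k n = exp_coef_rec g l n.
Proof.
elim: k l n => // k IH [//|l] [//|n] nk nl /=; congr (_ * _).
apply: eq_bigr => i _; rewrite (IH l) //; have := ltn_ord i; lia.
Qed.

Lemma exp_coef0 g : exp_coef g 0 = 1. Proof. by []. Qed.

Lemma exp_coefS g n :
  n.+1%:R * exp_coef g n.+1 = \sum_(i < n.+1) exp_coef g i * g (n.+1 - i)%N.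
Proof.
have -> : exp_coef g n.+1 =
    n.+1%:R^-1 * \sum_(i < n.+1) exp_coef_rec g n.+1 i * g (n.+1 - i)%N by [].
rewrite mulVKf ?pnatr_eq0 //; apply: eq_bigr => i _; congr (_ * _).
by apply: exp_coef_recE.
Qed.

Lemma exp_coefE g n : g 0%N = 0 -> n%:R * exp_coef g n = conv (exp_coef g) g n.
Proof.
move=> g0; rewrite /conv big_ord_recr /= subnn g0 mulr0 addr0.
case: n => [|n]; first by rewrite mul0r big_ord0.
exact: exp_coefS.
Qed.

Lemma exp_coef_unique g w : g 0%N = 0 -> w 0%N = 1 ->
  (forall n, n%:R * w n = conv w g n) -> w =1 exp_coef g.
Proof.
move=> g0 w0 Dw; elim/ltn_ind => -[|n] IH //.
apply: (mulfI (_ : n.+1%:R != 0 :> R)); first by rewrite pnatr_eq0.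
rewrite Dw exp_coefE // /conv !big_ord_recr /= subnn g0 !mulr0 !addr0.
rewrite IH // subSnn; congr (_ + _).
by apply: eq_bigr => i _; rewrite IH //; have := ltn_ord i; lia.
Qed.

(** The exponential of a sum is the product of the exponentials, as both sides
    solve the same differential equation. *)
Lemma exp_coefD g g' : g 0%N = 0 -> g' 0%N = 0 ->
  conv (exp_coef g) (exp_coef g') =1 exp_coef (fun i => g i + g' i).
Proof.
move=> g0 g'0; apply: exp_coef_unique.
- by rewrite g0 g'0 addr0.
- by rewrite /conv big_ord_recr big_ord0 /= add0r mulr1.
move=> n; rewrite deriv_conv convDr; congr (_ + _).
  rewrite -convA (eq_conv (u' := conv (exp_coef g) g) (v' := exp_coef g')) //.
    rewrite -convA; apply: eq_conv => // i _; exact: convC.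
  by move=> i _; rewrite exp_coefE.
rewrite -convA; apply: eq_conv => // i _; exact: exp_coefE.
Qed.

Lemma exp_coef_norm g g' n : (forall i, `|g i| <= g' i) -> `|exp_coef g n| <= exp_coef g' n.
Proof.
move=> gg'; elim/ltn_ind: n => -[|n] IH; first by rewrite !exp_coef0 normr1.
rewrite -(ler_pM2l (_ : 0 < n.+1%:R)) ?ltr0n // -{1}(ger0_norm (ler0n R n.+1)) -normrM !exp_coefS.
apply: le_trans (ler_norm_sum _ _ _) _; apply: ler_sum => i _.
by rewrite normrM ler_pM // IH.
Qed.

Lemma exp_coef_ge0 g n : (forall i, 0 <= g i) -> 0 <= exp_coef g n.
Proof.
move=> g0; apply: le_trans (exp_coef_norm (g := g) n _); first exact: normr_ge0.
by move=> i; rewrite ger0_norm.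
Qed.

Lemma exp_coef_le1 g n : (forall i, 0 <= g i <= 1) -> exp_coef g n <= 1.
Proof.
move=> g01; elim/ltn_ind: n => -[|n] IH; first by rewrite exp_coef0.
rewrite -(ler_pM2l (_ : 0 < n.+1%:R)) ?ltr0n // mulr1 exp_coefS.
rewrite -[X in _ <= X%:R]card_ord -[X in _ <= X]mulr1 mulr_natl -sumr_const.
apply: ler_sum => i _; have /andP[g0 g1] := g01 (n.+1 - i)%N.
by rewrite mulr_ile1 ?IH // exp_coef_ge0 // => j; have /andP[] := g01 j.
Qed.

Definition ind (A : pred nat) (j : nat) : R := ((0 < j)%N && A j)%:R.

Lemma ind0 A : ind A 0 = 0. Proof. by []. Qed.
Lemma ind_ge0 A j : 0 <= ind A j. Proof. exact: ler0n. Qed.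
Lemma ind_01 A j : 0 <= ind A j <= 1. Proof. by rewrite /ind ler0n lern1 leq_b1. Qed.

(** The proportion of permutations of n points with all cycle lengths in A, as
    [card_cycle_perms] shows. *)
Definition cycle_weight A := exp_coef (ind A).

Lemma cycle_weight_ge0 A n : 0 <= cycle_weight A n.
Proof. by apply: exp_coef_ge0 => i; exact: ind_ge0. Qed.
Lemma cycle_weight_le1 A n : cycle_weight A n <= 1.
Proof. by apply: exp_coef_le1 => i; exact: ind_01. Qed.

Lemma exp_coef_ind_all n : exp_coef (ind predT) n = 1.
Proof.
rewrite -(@exp_coef_unique (ind predT) (fun=> 1)) // => m.
rewrite mulr1 /conv big_ord_recr /= subnn ind0 mulr0 addr0.
rewrite (eq_bigr (fun=> 1)) ?sumr_const ?card_ord // => i _.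
by rewrite /ind subn_gt0 ltn_ord mulr1.
Qed.

(** The generating function of A is 1 / (1 - z) times the exponential attached to
    minus the complement of A; hence its coefficients are partial sums. *)
Lemma sum_exp_coef A n :
  cycle_weight A n = \sum_(i < n.+1) exp_coef (fun j => - ind (predC A) j) i.
Proof.
have -> : cycle_weight A n = exp_coef (fun i => ind predT i + - ind (predC A) i) n.
  rewrite /cycle_weight; congr (exp_coef _ n); apply: funext => i; rewrite /ind /=.
  by case: (0 < i)%N; case: (A i) => //=; rewrite ?subr0 ?subrr ?oppr0 ?addr0.
rewrite -exp_coefD ?ind0 ?oppr0 // convC; apply: eq_bigr => i _.
by rewrite exp_coef_ind_all mulr1.
Qed.

(** Every permutation splits uniquely into its cycles with length in A and its
    other cycles. *)
Lemma conv_cycle_weightC A n : conv (cycle_weight (predC A)) (cycle_weight A) n = 1.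
Proof.
rewrite exp_coefD ?ind0 // -(exp_coef_ind_all n); congr (exp_coef _ n).
apply: funext => i; rewrite /ind /=.
by case: (0 < i)%N; case: (A i) => //=; rewrite ?addr0 ?add0r.
Qed.

(** * Cycle lengths in a finite set *)

(** The summand for i is, up to normalization, the weight of the permutations
    with exactly i points on j-cycles; the product counts the ways to choose
    successively a point on each of k distinct j-cycles, so the sum is an
    unnormalized k-th factorial moment of the number of j-cycles, up to the
    factor j^k. *)
Lemma cycle_weight_remove (A : pred nat) j k n : (0 < j)%N -> A j -> (k * j <= n)%N ->
  cycle_weight A (n - k * j) =
  \sum_(i < n.+1) (\prod_(l < k) (i - l * j))%:R *
    (cycle_weight (pred1 j) i * cycle_weight (predD1 A j) (n - i)).
Proof.
move=> j0 Aj kjn; set e := cycle_weight (pred1 j).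
have eA m : cycle_weight A m = conv e (cycle_weight (predD1 A j)) m.
  rewrite exp_coefD ?ind0 //; congr (exp_coef _ m); apply: funext => i; rewrite /ind /=.
  case: eqVneq => [->|]; first by rewrite j0 Aj /= addr0.
  by rewrite andbF add0r.
have eS i : i%:R * e i = if (j <= i)%N then e (i - j)%N else 0.
  rewrite exp_coefE ?ind0 //; case: leqP => ji.
    rewrite /conv (bigD1 (inord (i - j))) //= inordK ?ltnS ?leq_subr // subKn //.
    have -> : ind (pred1 j) j = 1 by rewrite /ind j0 /= eqxx.
    rewrite mulr1 big1 ?addr0 // => l; rewrite -val_eqE /= inordK ?ltnS ?leq_subr //.
    move=> lij; rewrite /ind /=; case: eqVneq; rewrite ?andbF ?mulr0 // => E.
    by move: lij; rewrite -E subKn ?eqxx // -ltnS.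
  rewrite /conv big1 // => l _; rewrite /ind /=; case: eqVneq; rewrite ?andbF ?mulr0 // => E.
  by exfalso; move: ji; rewrite -E; have := leq_subr l i; lia.
have eP i : (\prod_(l < k) (i - l * j))%:R * e i = if (k * j <= i)%N then e (i - k * j)%N else 0.
  elim: k {kjn} => [|k IH]; first by rewrite big_ord0 mul1r subn0.
  rewrite big_ord_recr /= natrM mulrAC IH; case: ifP => kji; last first.
    by rewrite mul0r; case: ifP => //; move: kji; rewrite mulSn; lia.
  rewrite mulrC eS leq_subRL // mulSnr; case: ifP => // _; congr e; lia.
under eq_bigr do rewrite mulrA eP.
rewrite eA /conv -(big_mkord xpredT (fun i => e i * cycle_weight (predD1 A j) (n - k * j - i))).
rewrite -(big_mkord xpredT (fun i => (if (k * j <= i)%N then e (i - k * j)%N else 0) *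
   cycle_weight (predD1 A j) (n - i))).
rewrite [RHS](big_cat_nat (n := k * j)) //=; last by lia.
rewrite [X in _ = X + _]big_nat [X in _ = X + _]big1 ?add0r; last first.
  by move=> i /andP[_ ik]; rewrite leqNgt ik mul0r.
rewrite -[X in _ = \sum_(X <= _ < _) _]add0n big_addn -subSn //; apply: eq_bigr => i _.
rewrite leq_addl addnK; congr (_ * cycle_weight _ _); lia.
Qed.

Lemma cycle_weight_shift (A : pred nat) j n : (0 < j)%N -> A j -> (j <= n)%N ->
  cycle_weight A (n - j) <= n%:R * cycle_weight A n.
Proof.
move=> j0 Aj jn; rewrite exp_coefE // /conv (bigD1 (inord (n - j))) //=.
rewrite inordK ?ltnS ?leq_subr // subKn // /ind j0 Aj mulr1 lerDl sumr_ge0 // => i _.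
by rewrite mulr_ge0 ?cycle_weight_ge0 ?ler0n.
Qed.

(** For j < d the mean number of points on j-cycles is o(n), since m is
    arbitrary.  Exchanging d cycles of length j for j cycles of length d
    shows that the d-th factorial moment of the number of j-cycles is at most of
    order n^j, hence of order n^(d-1): more than a small proportion of points on
    j-cycles has too small a weight to matter.  The threshold is K = d j + q with
    q about n / m. *)
Lemma cycle_weight_finite (A : pred nat) d j m n : (0 < j < d)%N -> A j -> A d -> (0 < m)%N ->
  (d * j <= n)%N ->
  cycle_weight A (n - j) <= (d * j + (n %/ m).+1 + m ^ d.-1)%:R * cycle_weight A n.
Proof.
move=> /andP[j0 jd] Aj Ad m0 djn; set q := (n %/ m).+1; set K := (d * j + q)%N.
have nmq : (n <= m * q)%N by rewrite mulnC ltnW // ltn_ceil.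
have q0 : (0 < q)%N by [].
pose w i := cycle_weight (pred1 j) i * cycle_weight (predD1 A j) (n - i).
have w0 i : 0 <= w i by rewrite mulr_ge0 ?cycle_weight_ge0.
have d0 : (0 < d)%N by lia.
(* Below K the first term dominates; above K each of the d - 1 last factors of
   the product is at least q. *)
have step i : (i * q ^ d.-1 <= K * q ^ d.-1 + \prod_(l < d) (i - l * j))%N.
  case: (leqP i K) => iK; first by rewrite (leq_trans _ (leq_addr _ _)) // leq_mul2r iK orbT.
  apply: leq_trans (leq_addl _ _); rewrite -(big_mkord xpredT (fun l => i - l * j))%N.
  rewrite big_ltn // -{2}(prednK d0) big_add1 /= big_mkord mul0n subn0.
  rewrite leq_mul2l; apply/orP; right.
  rewrite -[X in (q ^ X)%N]card_ord -prod_nat_const; apply: leq_prod => l _.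
  have : (l.+1 * j <= d * j)%N.
    by rewrite leq_mul2r; have := ltn_ord l; lia.
  move: iK; rewrite /K; lia.
have a0 := cycle_weight_remove (k := 0) j0 Aj (leq0n n).
have a1 : cycle_weight A (n - 1 * j) = _ := cycle_weight_remove j0 Aj _.
have ad := cycle_weight_remove j0 Aj djn.
have {}a0 : cycle_weight A n = \sum_(i < n.+1) w i.
  move: a0; rewrite mul0n subn0 => ->; apply: eq_bigr => i _; by rewrite big_ord0 mul1r.
have {}a1 : cycle_weight A (n - j) = \sum_(i < n.+1) i%:R * w i.
  have jn : (1 * j <= n)%N by rewrite mul1n; nia.
  move: (a1 jn); rewrite mul1n => ->; apply: eq_bigr => i _.
  by rewrite big_ord_recl big_ord0 muln1 mul0n subn0.
have qd0 : 0 < (q ^ d.-1)%:R :> R by rewrite ltr0n expn_gt0.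
have adn : cycle_weight A (n - d * j) <= (m ^ d.-1 * q ^ d.-1)%:R * cycle_weight A n.
  apply: (@le_trans _ _ ((n ^ j)%:R * cycle_weight A n)); last first.
    rewrite ler_wpM2r ?cycle_weight_ge0 // ler_nat -expnMn.
    have n0 : (0 < n)%N by nia.
    apply: (@leq_trans (n ^ d.-1)); first by apply: leq_pexp2l => //; lia.
    by case: (d.-1) => // d'; rewrite leq_exp2r.
  rewrite mulnC; have : (j * d <= n)%N by rewrite mulnC.
  elim: (j) => [|i IH] idn; first by rewrite mul0n subn0 expn0 mul1r.
  have idn' : (i * d <= n)%N by move: idn; rewrite mulSn; lia.
  rewrite mulSnr subnDA; apply: (le_trans (cycle_weight_shift d0 Ad _)).
    by rewrite leq_subRL // -mulSnr.
  rewrite expnS natrM -mulrA; apply: ler_pM; rewrite ?ler0n ?cycle_weight_ge0 ?IH //.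
  by rewrite ler_nat leq_subr.
rewrite -(ler_pM2r qd0) mulrAC -natrM mulnDl natrD mulrDl.
apply: le_trans (_ : (K * q ^ d.-1)%:R * cycle_weight A n + cycle_weight A (n - d * j) <= _); last first.
  by rewrite lerD2l.
rewrite a0 a1 ad mulr_suml mulr_sumr -big_split /=; apply: ler_sum => i _.
by rewrite -mulrDl mulrAC -natrM -natrD ler_wpM2r // ler_nat.
Qed.

(** * Cycle lengths outside a set with summable reciprocals *)

(** Convergence of exp (sum of z^j / j over j in B) at z = 1, without
    exponentials.  Sum the recurrence for the weights H over n: the lengths
    j >= K contribute at most half of the sum S, and each j < K contributes
    H (m - j) / m, which is at most 1 if m < 4 K and at most H (m - j) / (4 K)
    otherwise, so that together they contribute at most 4 K^2 + S / 4. *)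
Lemma sum_cycle_weight_bounded (B : pred nat) K :
  (forall n, \sum_(K <= j < n | B j) (j%:R^-1 : R) <= 2^-1) ->
  forall n, \sum_(i < n) cycle_weight B i <= 4 * (1 + 4 * K%:R ^+ 2).
Proof.
move=> tailK n; set H := cycle_weight B; set S := \sum_(i < n) H i.
have H0 i : 0 <= H i := cycle_weight_ge0 B i.
have S0 : 0 <= S by apply: sumr_ge0.
pose s j m := if (j <= m)%N then H (m - j)%N else 0.
have s0 j m : 0 <= s j m by rewrite /s; case: ifP.
have s1 j m : s j m <= 1 by rewrite /s; case: ifP => _; rewrite ?cycle_weight_le1 ?ler01.
have sS j : \sum_(m < n) s j m <= S.
  have [nj|jn] := leqP n j.
    by rewrite big1 // => m _; rewrite /s leqNgt (leq_trans (ltn_ord m) nj).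
  rewrite -(big_mkord xpredT (s j)) (big_cat_nat (n := j)) //=; last exact: ltnW.
  rewrite big_nat big1 ?add0r => [|m /andP[_ mj]]; last by rewrite /s leqNgt mj.
  rewrite -{1}[j]add0n big_addn /S -(big_mkord xpredT H).
  rewrite [leRHS](big_cat_nat (n := (n - j)%N)) ?leq_subr //=.
  rewrite (eq_bigr H) => [|m _]; last by rewrite /s leq_addl addnK.
  by rewrite lerDl sumr_ge0.
pose r j : R := if (K <= j)%N then (if B j then j%:R^-1 * S else 0) else (4 * K)%:R + S / (4 * K)%:R.
have HE m : (0 < m)%N -> H m <= \sum_(j < m.+1) ind B j * (s j m / m%:R).
  move=> m0; rewrite -(ler_pM2l (_ : 0 < m%:R)) ?ltr0n // exp_coefE ?ind0 // convC.
  rewrite mulr_sumr; apply: ler_sum => j _; rewrite /s -ltnS ltn_ord.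
  by rewrite mulrCA [m%:R * _]mulrC divfK // pnatr_eq0; lia.
have step : S <= 1 + \sum_(j < n) r j.
  apply: (@le_trans _ _ (1 + \sum_(m < n) \sum_(j < n) ind B j * (s j m / m%:R))).
    have t0 m : 0 <= \sum_(j < n) ind B j * (s j m / m%:R).
      by apply: sumr_ge0 => j _; rewrite mulr_ge0 ?divr_ge0 ?ler0n.
    rewrite /S; case: (n) t0 => [|n'] t0; first by rewrite !big_ord0 addr0.
    rewrite big_ord_recl (_ : H (@ord0 n') = 1) //= lerD2l [leRHS]big_ord_recl.
    apply: le_trans (_ : _ <= \sum_(i < n') \sum_(j < n'.+1) ind B j * (s j i.+1 / i.+1%:R)) _; last first.
      by rewrite lerDr.
    apply: ler_sum => m _; apply: le_trans (HE _ _) _ => //.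
    rewrite -!(big_mkord xpredT (fun j => ind B j * (s j m.+1 / m.+1%:R))).
    rewrite [leRHS](big_cat_nat (n := m.+2)) ?ltnS //=.
    by rewrite lerDl; apply: sumr_ge0 => j _; rewrite mulr_ge0 ?divr_ge0 ?ler0n.
  rewrite lerD2l exchange_big /=; apply: ler_sum => j _; rewrite /r /ind.
  have [->|j0] := posnP j.
    rewrite big1 => [|m _]; last by rewrite mul0r.
    by case: ifP => _; rewrite ?invr0 ?mul0r ?if_same // addr_ge0 ?divr_ge0 ?ler0n.
  case: (B j) => /=; last first.
    rewrite big1 => [|m _]; last by rewrite mul0r.
    by case: ifP => _ //; rewrite addr_ge0 ?divr_ge0 ?ler0n.
  under eq_bigr do rewrite mul1r.
  case: leqP => jK.
    apply: le_trans (_ : _ <= \sum_(m < n) j%:R^-1 * s j m) _; last first.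
      by rewrite -mulr_sumr ler_wpM2l ?sS // invr_ge0 ler0n.
    apply: ler_sum => m _; rewrite mulrC; rewrite /s; case: ifP => jm; last by rewrite !mulr0.
    by rewrite ler_wpM2r // lef_pV2 ?ler_nat // posrE ltr0n; lia.
  apply: le_trans (_ : _ <= \sum_(m < n) ((m < 4 * K)%N%:R + s j m / (4 * K)%:R)) _.
    apply: ler_sum => m _; case: ltnP => mK.
      apply: le_trans (_ : _ <= 1) _; last by rewrite lerDl divr_ge0 ?ler0n.
      rewrite /s; case: ifP => jm; last by rewrite mul0r ler01.
      by rewrite ler_pdivrMr ?mul1r ?ltr0n; [rewrite (le_trans (cycle_weight_le1 _ _)) // ler1n; lia|lia].
    rewrite add0r ler_wpM2l // lef_pV2 ?ler_nat // posrE ltr0n; lia.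
  rewrite big_split /= -mulr_suml lerD ?ler_wpM2r ?invr_ge0 ?ler0n ?sS //.
  rewrite -natr_sum ler_nat -(big_mkord xpredT (fun m => (m < 4 * K)%N : nat)).
  apply: (@leq_trans (\sum_(0 <= m < 4 * K) 1)); last by rewrite sum_nat_const_nat subn0 muln1.
  have [nK|Kn] := leqP n (4 * K).
    rewrite [leqRHS](big_cat_nat (n := n)) //=; apply: leq_trans (leq_addr _ _).
    by apply: leq_sum => m _; apply: leq_b1.
  rewrite (big_cat_nat (n := 4 * K)) //=; last exact: ltnW.
  rewrite [X in (_ + X <= _)%N]big_nat [X in (_ + X <= _)%N]big1 ?addn0; last by move=> m /andP[Km _]; rewrite ltnNge Km.
  by apply: leq_sum => m _; apply: leq_b1.
have rS : \sum_(j < n) r j <= S / 2 + (4 * K%:R ^+ 2 + S / 4).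
  have rlt : \sum_(j < K) ((4 * K)%:R + S / (4 * K)%:R) <= 4 * K%:R ^+ 2 + S / 4.
    rewrite sumr_const card_ord -mulr_natr natrM; have [->|K0] := posnP K.
      by rewrite mulr0 mulr0n expr0n /= mulr0 add0r divr_ge0.
    have K1 : K%:R != 0 :> R by rewrite pnatr_eq0; lia.
    rewrite le_eqVlt; apply/orP; left; apply/eqP; field; exact: K1.
  have rlt' : forall l, (l <= K)%N -> \sum_(0 <= j < l) r j <= 4 * K%:R ^+ 2 + S / 4.
    move=> l lK; apply: le_trans rlt; rewrite -(big_mkord xpredT (fun=> (4 * K)%:R + S / (4 * K)%:R)).
    rewrite [leRHS](big_cat_nat (n := l)) //= -[leLHS]addr0 lerD //; last first.
      by rewrite sumr_ge0 // => j _; rewrite addr_ge0 ?divr_ge0 ?ler0n.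
    by rewrite !big_nat; apply: ler_sum => j /andP[_ jl]; rewrite /r leqNgt (leq_trans jl lK).
  rewrite -(big_mkord xpredT r); have [nK|Kn] := leqP n K.
    by apply: le_trans (rlt' _ nK) _; rewrite lerDr divr_ge0.
  rewrite (big_cat_nat (n := K)) //=; last exact: ltnW.
  rewrite addrC lerD ?rlt' //.
  apply: le_trans (_ : _ <= (\sum_(K <= j < n | B j) j%:R^-1) * S) _; last first.
    by rewrite [leRHS]mulrC ler_wpM2r.
  rewrite mulr_suml [leRHS]big_mkcond /= !big_nat; apply: ler_sum => j /andP[Kj _].
  by rewrite /r Kj.
by move: (\sum_(j < n) r j) step rS => X; move: (K%:R ^+ 2) => k2; lra.
Qed.

Lemma bounded_series_tail (v : nat -> R) M :
  (forall i, 0 <= v i) -> (forall n, \sum_(i < n) v i <= M) ->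
  forall e, 0 < e -> exists n0, forall m n, (n0 <= m <= n)%N -> \sum_(m <= i < n) v i <= e.
Proof.
move=> v0 vM e e0; pose s n := \sum_(i < n) v i.
have sP : has_sup (range s).
  split; first by exists (s 0%N); exists 0%N.
  by exists M => _ [n _ <-]; exact: vM.
have [_ [n0 _ <-] n0P] := sup_adherent e0 sP.
exists n0 => m n /andP[n0m mn].
have sn : s n <= sup (range s) by apply: ub_le_sup; [case: sP | exists n].
have snm : s n = s m + \sum_(m <= i < n) v i.
  by rewrite /s -!(big_mkord xpredT v) (big_cat_nat (n := m)).
have smn0 : s n0 <= s m.
  by rewrite /s -!(big_mkord xpredT v) [leRHS](big_cat_nat (n := n0)) //= lerDl sumr_ge0.
by move: n0P; rewrite ltrBlDr; lra.
Qed.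

(** Let H and a be the weights of the complement of A and of A.  The increments
    of a are bounded by H, which is summable, so a is nearly constant
    far away; and the convolution of H and a is 1.  Restricting this convolution
    to its first N1 terms loses at most 1/2, which forces
    1/2 <= T (a n + 1 / (4 T)) for large n, where T bounds the sum of H. *)
Lemma cycle_weight_lower (A : pred nat) K :
  (forall n, \sum_(K <= j < n | ~~ A j) (j%:R^-1 : R) <= 2^-1) ->
  exists2 c : R, 0 < c & exists n0, forall n, (n0 <= n)%N -> c <= cycle_weight A n.
Proof.
move=> tailK; set H := cycle_weight (predC A).
have H0 i : 0 <= H i := cycle_weight_ge0 _ i.
set T := 4 * (1 + 4 * K%:R ^+ 2) : R.
have HT n : \sum_(i < n) H i <= T by exact: sum_cycle_weight_bounded.
have T0 : 0 < T by rewrite mulr_gt0 // ltr_wpDr ?mulr_ge0 ?exprn_ge0.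
have tail := bounded_series_tail H0 HT.
have [|N1 N1P] := tail 2^-1; first by rewrite invr_gt0.
have [|N2 N2P] := tail (T^-1 / 4); first by rewrite divr_gt0 ?invr_gt0.
exists (T^-1 / 4); first by rewrite divr_gt0 ?invr_gt0.
exists (N1 + N2)%N => n nN; set a := cycle_weight A.
have a1 i : a i <= 1 := cycle_weight_le1 A i.
have near i : (i < N1)%N -> a (n - i)%N <= a n + T^-1 / 4.
  move=> iN; rewrite /a !sum_exp_coef -!(big_mkord xpredT (exp_coef (fun j => - ind (predC A) j))).
  rewrite [X in _ <= X + _](big_cat_nat (n := (n - i).+1)) ?ltnS ?leq_subr //= -addrA lerDl.
  rewrite -lerBlDl sub0r; apply: le_trans (_ : _ <= \sum_((n - i).+1 <= j < n.+1) H j) _.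
    apply: le_trans (ler_norm _) _; rewrite normrN.
    apply: le_trans (ler_norm_sum _ _ _) _; apply: ler_sum => j _.
    by apply: exp_coef_norm => l; rewrite normrN ger0_norm ?ind_ge0.
  by apply: N2P; apply/andP; split; lia.
have := conv_cycle_weightC A n; rewrite /conv -/H -/a -(big_mkord xpredT (fun i => H i * a (n - i)%N)).
rewrite (big_cat_nat (n := N1)) //=; last lia.
set X := (X in X + _ = 1); set Y := (X in _ + X = 1) => XY.
have Y2 : Y <= 2^-1.
  apply: le_trans (_ : _ <= \sum_(N1 <= j < n.+1) H j) _; last by apply: N1P; lia.
  by rewrite /Y; apply: ler_sum => j _; rewrite ler_piMr.
have XT : X <= T * (a n + T^-1 / 4).
  apply: le_trans (_ : _ <= (\sum_(0 <= i < N1) H i) * (a n + T^-1 / 4)) _.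
    by rewrite mulr_suml /X !big_nat; apply: ler_sum => i /andP[_ iN]; rewrite ler_wpM2l // near.
  rewrite big_mkord ler_wpM2r ?HT // addr_ge0 ?cycle_weight_ge0 // divr_ge0 ?invr_ge0 ?ltW //.
have : 2^-1 <= T * (a n + T^-1 / 4) by lra.
rewrite -ler_pdivrMl //; set t := T^-1; lra.
Qed.
End Convolution.

(** * Counting permutations with restricted cycle lengths *)

Section CycleCounts.
Import mathcomp.boot.fintype mathcomp.boot.finset.
Variables (R : realType) (T : finType) (A : pred nat).
Implicit Types (S C : {set T}).

Definition weight_formula S :=
  #|cycle_perms S A|%:R = (#|S| `!)%:R * cycle_weight R A #|S|.

(** The step of the induction that proves [card_cycle_perms]: sum over the
    possible cycles C of x with j elements. *)
Lemma card_porbit_size_rec S x j :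
  (forall S', (#|S'| < #|S|)%N -> weight_formula S') -> x \in S -> (0 < j <= #|S|)%N ->
  #|[set s in cycle_perms S A | #|porbit s x| == j]|%:R =
  ((#|S|.-1)`!)%:R * (ind R A j * cycle_weight R A (#|S| - j)) :> R.
Proof.
move=> IH xS /andP[j0 jS].
have part : #|[set s in cycle_perms S A | #|porbit s x| == j]| =
    (\sum_(C : {set T} | (x \in C) && (C \subset S) && (#|C| == j))
       #|[set s in cycle_perms S A | porbit s x == C]|)%N.
  rewrite -sum1_card (partition_big (fun s => porbit s x)
     (fun C : {set T} => (x \in C) && (C \subset S) && (#|C| == j))) /=.
    apply: eq_bigr => C /andP[_ Cj]; rewrite -sum1_card; apply: eq_bigl => s.
    rewrite [RHS]inE inE; case: (eqVneq (porbit s x) C) => [->|]; first by rewrite Cj !andbT.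
    by rewrite !andbF.
  move=> s; rewrite inE => /andP[sA ->]; rewrite porbit_id andbT /=.
  by move: sA; rewrite inE => /andP[sS _]; exact: perm_on_porbit.
have num : (\sum_(C : {set T} | (x \in C) && (C \subset S) && (#|C| == j)) 1)%N = 'C(#|S|.-1, j.-1).
  have := sum_supsets (fun m => (m == j) : nat) xS.
  rewrite [LHS](bigID (fun C : {set T} => #|C| == j)) /=.
  rewrite [X in (_ + X)%N = _]big1 ?addn0; last by move=> C /andP[_ /negPf ->].
  rewrite (eq_bigr (fun=> 1%N)); last by move=> C /andP[_ ->].
  move=> ->; have jS' : (j.-1 < #|S|)%N by lia.
  rewrite (bigD1 (Ordinal jS')) //= prednK // eqxx muln1 big1 ?addn0 // => i.
  rewrite -val_eqE /= => ij; case: eqP; rewrite ?muln0 // => E.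
  by move: ij; rewrite -E eqxx.
rewrite part natr_sum.
rewrite (eq_bigr (fun=> 1%:R * (ind R A j * ((j.-1)`! * (#|S| - j)`!)%:R * cycle_weight R A (#|S| - j)))).
  rewrite -mulr_suml -natr_sum num.
  have <- : ('C(#|S|.-1, j.-1) * ((j.-1)`! * (#|S| - j)`!))%N = (#|S|.-1)`!.
    have -> : (#|S| - j = #|S|.-1 - j.-1)%N by lia.
    by rewrite bin_fact //; lia.
  by rewrite natrM; ring.
move=> C /andP[/andP[xC CS] /eqP Cj]; rewrite mul1r.
rewrite (card_cycle_perms_porbit A CS xC) card_full_cycles // Cj /ind j0 /= !natrM.
have cD : #|S :\: C| = (#|S| - j)%N by rewrite cardsD (setIidPr CS) Cj.
rewrite IH cD; first by ring.
by rewrite -Cj; lia.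
Qed.

Lemma card_cycle_perms S : weight_formula S.
Proof.
move: S; suff H n : forall S, (#|S| < n)%N -> weight_formula S by move=> S; exact: (H #|S|.+1).
elim: n => // n IH S; rewrite ltnS => Sn; rewrite /weight_formula.
case: (set_0Vmem S) => [S0|[x xS]].
  rewrite S0 cards0 fact0 /cycle_weight exp_coef0 mulr1.
  have card1 : #|cycle_perms (@finset.set0 T) A| = (#|@finset.set0 T| `!)%N.
    rewrite -(card_perm (@finset.set0 T)).
    apply: eq_card => s; rewrite inE; apply/andb_idr => _.
    by apply/forall_inP => y; rewrite inE.
  by rewrite card1 cards0.
have S0 : (0 < #|S|)%N by apply/card_gt0P; exists x.
have size_orb s : s \in cycle_perms S A -> (0 < #|porbit s x| <= #|S|)%N.
  rewrite inE => /andP[sS _]; rewrite lt0n card_porbit_neq0.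
  by apply: subset_leq_card; exact: perm_on_porbit.
have -> : #|cycle_perms S A|%:R = \sum_(0 <= i < #|S|)
    #|[set s in cycle_perms S A | #|porbit s x| == (#|S| - i)%N]|%:R :> R.
  rewrite -natr_sum big_mkord; congr _%:R.
  rewrite -sum1_card; case E: #|S| S0 => [//|m] _.
  rewrite (partition_big (fun s => inord (#|S| - #|porbit s x|) : 'I_m.+1) xpredT) //=.
  apply: eq_bigr => i _; rewrite -[RHS]sum1_card; apply: eq_bigl => s.
  rewrite [RHS]inE; case: (boolP (s \in _)) => //= sA.
  have /andP[c1 c2] := size_orb s sA.
  by rewrite -val_eqE /= inordK; have := ltn_ord i; lia.
rewrite big_nat (eq_bigr (fun i => ((#|S|.-1)`!)%:R *
   (cycle_weight R A i * ind R A (#|S| - i)))); last first.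
  move=> i /andP[_ iS]; rewrite card_porbit_size_rec //; last by lia.
    by rewrite subKn 1?ltnW // [ind _ _ _ * _]mulrC.
  by move=> S' S'S; apply: IH; apply: leq_trans S'S _.
rewrite -big_nat -mulr_sumr big_mkord; case: #|S| S0 => // m _.
rewrite -exp_coefS factS natrM mulrCA mulrA; congr (_ * _).
Qed.

Lemma card_porbit_size S x j : x \in S -> (0 < j <= #|S|)%N ->
  #|[set s in cycle_perms S A | #|porbit s x| == j]|%:R =
  ((#|S|.-1)`!)%:R * (ind R A j * cycle_weight R A (#|S| - j)) :> R.
Proof. by apply: card_porbit_size_rec => S' _; exact: card_cycle_perms. Qed.

(** Divided by the number of permutations, this is the mean number of points on
    j-cycles. *)
Lemma sum_porbit_size j : (0 < j <= #|T|)%N ->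
  (\sum_(s in cycle_perms [set: T] A) #|[set x | #|porbit s x| == j]|)%:R =
  (#|T| `!)%:R * (ind R A j * cycle_weight R A (#|T| - j)) :> R.
Proof.
move=> j0; have -> : (\sum_(s in cycle_perms [set: T] A) #|[set x | #|porbit s x| == j]| =
    \sum_x #|[set s in cycle_perms [set: T] A | #|porbit s x| == j]|)%N.
  rewrite -(double_count (fun s x => (s \in cycle_perms [set: T] A) && (#|porbit s x| == j))).
  rewrite big_mkcond; apply: eq_bigr => s _; case: (s \in _) => //=.
  by rewrite eq_card0 // => x; rewrite inE.
rewrite natr_sum (eq_bigr (fun=> ((#|T|.-1)`!)%:R * (ind R A j * cycle_weight R A (#|T| - j)))).
  rewrite sumr_const -[LHS]mulr_natl mulrA -natrM; congr (_%:R * _).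
  rewrite (_ : #|xpredT| = #|T|); last exact: eq_card.
  by case: #|T| j0 => [|m _]; [case: (j)|rewrite factS].
by move=> x _; have := @card_porbit_size [set: T] x j; rewrite cardsT; apply.
Qed.
End CycleCounts.

(** * Averages over families of permutations *)

Section CycleAverages.
Import mathcomp.boot.fintype mathcomp.boot.finset.
Implicit Types (T : finType).

Definition nfix T (s : {perm T}) : nat := #|[set x | s x == x]|.
Definition nmoved T (s : {perm T}) : nat := #|[set x | s x != x]|.

Lemma perms_with_cyclesE N (A : set nat) :
  perms_with_cycles N A = cycle_perms [set: 'I_N] (fun n => n \in A).
Proof.
apply/setP => s; rewrite !inE.
have -> : perm_on [set: 'I_N] s by apply/subsetP => x _; rewrite inE.
apply/forall_inP/forall_inP => [H x _|H c /imsetP[x _ ->]]; last exact: H.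
by apply: H; apply: imset_f.
Qed.

Lemma sum_short_cycles (R : realType) T (A : pred nat) d m :
  A d -> (forall j, A j -> (j <= d)%N) -> (0 < m)%N -> (d * d <= #|T|)%N ->
  (\sum_(s in cycle_perms [set: T] A) #|[set x | #|porbit s x| != d]|)%:R <=
  (d * (d * d + (#|T| %/ m).+1 + m ^ d.-1))%:R * #|cycle_perms [set: T] A|%:R :> R.
Proof.
move=> Ad Amax m0 dT.
set B := (d * d + (#|T| %/ m).+1 + m ^ d.-1)%N.
pose Y j := (\sum_(s in cycle_perms [set: T] A) #|[set x | #|porbit s x| == j]|)%N.
have YB j : (j < d)%N -> (Y j)%:R <= B%:R * #|cycle_perms [set: T] A|%:R :> R.
  move=> jd; case: j jd => [|j] jd.
    rewrite /Y big1 ?mulr_ge0 // => s _; apply: eq_card0 => x.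
    by rewrite inE (negPf (card_porbit_neq0 s x)).
  rewrite /Y sum_porbit_size; last by apply/andP; split => //; nia.
  rewrite card_cycle_perms cardsT [leRHS]mulrCA ler_wpM2l //.
  have w0 := cycle_weight_ge0 R A #|T|.
  rewrite /ind /=; case: (boolP (A j.+1)) => Aj; last by rewrite mul0r mulr_ge0.
  rewrite mul1r; apply: le_trans (cycle_weight_finite R (d := d) _ Aj Ad m0 _) _ => //.
    by apply: leq_trans dT; rewrite leq_mul2l ltnW ?orbT.
  by rewrite ler_wpM2r // ler_nat /B !leq_add2r leq_mul2l (ltnW jd) orbT.
have sumY : (\sum_(s in cycle_perms [set: T] A) #|[set x | #|porbit s x| != d]| <= \sum_(j < d) Y j)%N.
  rewrite exchange_big /=; apply: leq_sum => s; rewrite inE => /andP[_ /forall_inP sA].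
  have sd x : (#|porbit s x| <= d)%N by apply: Amax; apply: sA.
  rewrite -sum1_card.
  have -> : (\sum_(j < d) #|[set x | #|porbit s x| == j]| =
            \sum_(j < d) \sum_x (#|porbit s x| == j))%N.
    by apply: eq_bigr => j _; rewrite -sum1_card big_mkcond; apply: eq_bigr => x _; rewrite inE; case: eqP.
  rewrite exchange_big big_mkcond; apply: leq_sum => x _; rewrite inE.
  case: eqVneq => //= sxd; have sxd' : (#|porbit s x| < d)%N by rewrite ltn_neqAle sxd sd.
  by rewrite (bigD1 (Ordinal sxd')) //= eqxx leq_addr.
apply: le_trans (_ : _ <= (\sum_(j < d) Y j)%:R) _; first by rewrite ler_nat.
rewrite natr_sum; apply: le_trans (_ : _ <= \sum_(j < d) B%:R * #|cycle_perms [set: T] A|%:R) _.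
  by apply: ler_sum => j _; exact: YB.
by rewrite sumr_const card_ord -[leLHS]mulr_natl natrM mulrA.
Qed.

(** A pair of points fixed by s^n is a pair of closed walks of length n for s. *)
Lemma sum_nfix_expg T n : (0 < n)%N ->
  (\sum_(s : {perm T}) nfix (s ^+ n)%g ^ 2 <=
     (2 * n) ^ (2 * n) * ((2 * n) ^ (2 * n) * (#|T| `!)))%N.
Proof.
case: n => // n _; case: (pickP (@predT T)) => [x0 _|T0]; last first.
  rewrite big1 // => s _; rewrite /nfix eq_card0 // => x.
  by have := T0 x.
have cI : #|{: bool * 'I_n.+1}| = (2 * n.+1)%N by rewrite card_prod card_bool card_ord.
have := sum_card_cycles x0 (fun i : bool * 'I_n.+1 => (i.1, ordS i.2)).
rewrite cI; apply: leq_trans; apply: leq_sum => s _.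
rewrite /nfix -mulnn -cardsX.
pose y (p : T * T) := [ffun i : bool * 'I_n.+1 => (s ^+ i.2)%g (if i.1 then p.1 else p.2)].
rewrite -(@card_imset _ _ y); last first.
  move=> [a b] [a' b'] /ffunP E; have := E (true, ord0); have := E (false, ord0).
  by rewrite !ffunE /= !perm1 => -> ->.
apply/subset_leq_card/subsetP => _ /imsetP[[a b] ab ->]; move: ab; rewrite !inE /=.
move=> /andP[/eqP sa /eqP sb]; apply/forallP => -[c i]; rewrite !ffunE /=; apply/eqP.
have sc : (s ^+ n.+1)%g (if c then a else b) = if c then a else b by case: c.
rewrite -[RHS]permM -expgSr; have [ni|ni] := ltnP i.+1 n.+1; first by rewrite modn_small.
have -> : i.+1 = n.+1 by apply/eqP; rewrite eqn_leq ni ltn_ord.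
by rewrite modnn expg0 perm1 sc.
Qed.

Definition loopless_walk T m (h : 'I_m -> {perm T}) (y : {ffun 'I_m -> T}) :=
  [forall i, (y (ordS i) != y i) && (y (ordS i) == h i (y i))].

(** Follow a fixed point x of the product through the factors.  If factor i fixes
    the point it receives, x is determined by that fixed point of h i;
    otherwise the trajectory of x is a loopless walk. *)
Lemma nfix_prod T m (h : 'I_m -> {perm T}) : (0 < m)%N ->
  (nfix (\prod_(i < m) h i)%g <=
    \sum_i nfix (h i) + #|[set y | loopless_walk h y]|)%N.
Proof.
case: m h => // n g _.
pose h' k := g (inord k); pose Q k := (\prod_(0 <= i < k) h' i)%g.
have QS k : Q k.+1 = (Q k * h' k)%g by rewrite /Q big_nat_recr.
have Qn : (\prod_(i < n.+1) g i)%g = Q n.+1.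
  by rewrite /Q big_mkord; apply: eq_bigr => i _; rewrite /h' inord_val.
rewrite Qn /nfix.
pose L (i : 'I_n.+1) := [set x | g i (Q i x) == Q i x].
have cL i : #|L i| = nfix (g i).
  rewrite /nfix -(card_imset _ (@perm_inj _ (Q i))); apply: eq_card => x.
  rewrite !inE; apply/imsetP/eqP => [[z] |gx].
    by rewrite inE => /eqP zL ->.
  by exists ((Q i)^-1 x)%g; rewrite ?inE permKV ?gx.
pose y x := [ffun i : 'I_n.+1 => Q i x].
have y_inj : injective y.
  by move=> a b /ffunP /(_ ord0); rewrite !ffunE /Q big_nil !perm1.
apply: (@leq_trans #|(\bigcup_i L i) :|: (y @^-1: [set y | loopless_walk g y])|).
  apply/subset_leq_card/subsetP => x; rewrite !inE => /eqP Qx.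
  case: (boolP (x \in \bigcup_i L i)) => //= /bigcupP noL.
  have yS i : y x (ordS i) = g i (y x i).
    have E : g i (y x i) = Q i.+1 x by rewrite ffunE QS permM /h' inord_val.
    rewrite E ffunE /=; have [ni|ni] := ltnP i.+1 n.+1; first by rewrite modn_small.
    have -> : i.+1 = n.+1 by apply/eqP; rewrite eqn_leq ni ltn_ord.
    by rewrite modnn Qx /Q big_nil perm1.
  apply/forallP => i; rewrite yS eqxx andbT; apply/negP => /eqP gi.
  by apply: noL; exists i => //; rewrite inE; move/eqP: gi; rewrite ffunE.
apply: leq_trans (leq_card_setU _ _) _; apply: leq_add.
  apply: leq_trans (_ : _ <= \sum_i #|L i|)%N _; last by apply: leq_sum => i _; rewrite cL.
  elim/big_rec2: _ => [|i a B _ IH]; first by rewrite cards0.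
  by apply: leq_trans (leq_card_setU _ _) _; rewrite leq_add2l.
rewrite -(card_imset _ y_inj); apply/subset_leq_card/subsetP => _ /imsetP[x xy ->].
by move: xy; rewrite !inE.
Qed.

Definition conj_family (K : finType) T (s t : {ffun K -> {perm T}}) : {ffun K -> {perm T}} :=
  [ffun r => (s r ^ (t r)^-1)%g].

(** Pairs of walks are walks indexed by two copies of the cycle of length m, which
    is why [sum_card_walks] allows any number of cycles. *)
Lemma sum_loopless_sqr (K : finType) T (x0 : T) m (c : 'I_m -> K) (g : 'I_m -> {perm T}) :
  (forall i, c (ordS i) != c i) ->
  (\sum_(t : {ffun K -> {perm T}})
     #|[set y | loopless_walk (fun i => g i ^ (t (c i))^-1)%g y]| ^ 2 <=
   (2 * m) ^ (2 * m) * ((2 * (2 * m)) ^ (2 * (2 * m)) * (#|T| `!)) ^ #|K|)%N.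
Proof.
move=> c_alt.
have cI : #|{: bool * 'I_m}| = (2 * m)%N by rewrite card_prod card_bool card_ord.
pose nxt (i : bool * 'I_m) := (i.1, ordS i.2).
pose prv (i : bool * 'I_m) := (i.1, ord_pred i.2).
have nxtK i : nxt (prv i) = i by case: i => b i; rewrite /nxt /= ord_predK.
have c_nxt i : c (nxt i).2 != c i.2 by exact: c_alt.
have := sum_card_walks x0 (fun i => g i.2) nxtK c_nxt.
rewrite cI -!mul2n; apply: leq_trans.
apply: leq_sum => t _; rewrite -mulnn -cardsX.
pose j (p : {ffun 'I_m -> T} * {ffun 'I_m -> T}) :=
  [ffun i : bool * 'I_m => if i.1 then p.1 i.2 else p.2 i.2].
rewrite -(@card_imset _ _ j); last first.
  move=> [a b] [a' b'] /ffunP E; congr pair; apply/ffunP => i.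
    by have := E (true, i); rewrite !ffunE.
  by have := E (false, i); rewrite !ffunE.
apply/subset_leq_card/subsetP => _ /imsetP[[a b] ab ->]; move: ab; rewrite !inE /=.
move=> /andP[/forallP wa /forallP wb]; apply/forallP => -[e i]; rewrite !ffunE /=.
have {wa wb} : ((if e then a else b) (ordS i) != (if e then a else b) i) &&
   ((if e then a else b) (ordS i) == (g i ^ (t (c i))^-1)%g ((if e then a else b) i)).
  by case: e.
have -> (f f' : {ffun 'I_m -> T}) : (if e then f i else f' i) = (if e then f else f') i by case: e.
have -> (f f' : {ffun 'I_m -> T}) : (if e then f (ordS i) else f' (ordS i)) =
   (if e then f else f') (ordS i) by case: e.
move=> /andP[-> /eqP ->] /=; apply/eqP.
by rewrite conjgE invgK !permM permKV.
Qed.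

Definition perm_family (K : finType) T (S : K -> {set {perm T}}) : {set {ffun K -> {perm T}}} :=
  [set f : {ffun K -> {perm T}} | [forall r, f r \in S r]].

Lemma card_perm_family (K : finType) T (S : K -> {set {perm T}}) :
  #|perm_family S| = (\prod_r #|S r|)%N.
Proof.
transitivity #|family S|; last by rewrite card_family foldrE big_map big_enum.
by apply: eq_card => f; rewrite inE.
Qed.

Lemma sum_marginal (K : finType) T (S : K -> {set {perm T}}) (F : {perm T} -> nat) r :
  (\sum_(f in perm_family S) F (f r) * #|S r| = #|perm_family S| * \sum_(s in S r) F s)%N.
Proof.
have -> : (\sum_(f in perm_family S) F (f r) * #|S r| =
   (\sum_(f in perm_family S) F (f r)) * #|S r|)%N by rewrite big_distrl.
have -> : (\sum_(f in perm_family S) F (f r) =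
   \prod_k \sum_(s in S k) (if k == r then F s else 1))%N.
  rewrite bigA_distr_big_dep; apply: eq_big => [f|f _]; first by rewrite inE; apply: eq_forallb.
  by rewrite (bigD1 r) //= eqxx big1 ?muln1 // => k /negPf ->.
rewrite card_perm_family (bigD1 r) //= eqxx (bigD1 (F := fun k => #|S k|) r) //=.
rewrite mulnC mulnA mulnAC; congr (_ * _ * _)%N.
apply: eq_bigr => k /negPf kr; rewrite -sum1_card; apply: eq_bigr => s _; by rewrite kr.
Qed.

(** Conjugation invariance turns a bound on the average over conjugates of each
    family into a bound on the average over all families. *)
Lemma sum_perm_family_conj (K : finType) T (S : K -> {set {perm T}}) (G : {ffun K -> {perm T}} -> nat) C :
  (forall r s t, s \in S r -> (s ^ t)%g \in S r) ->
  (forall f, f \in perm_family S ->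
     \sum_(t : {ffun K -> {perm T}}) G (conj_family f t) <= C * (#|T| `!) ^ #|K|)%N ->
  (\sum_(f in perm_family S) G f <= C * #|perm_family S|)%N.
Proof.
move=> SJ GC; pose M := ((#|T| `!) ^ #|K|)%N.
have cM : #|{: {ffun K -> {perm T}}}| = M.
  rewrite card_ffun /M -(cardsT T) -(card_perm [set: T]); congr (_ ^ _)%N.
  by apply: eq_card => s; rewrite !inE; apply/esym/subsetP => x; rewrite inE.
have M0 : (0 < M)%N by rewrite expn_gt0 fact_gt0.
rewrite -(leq_pmul2l M0).
have -> : (M * \sum_(f in perm_family S) G f =
    \sum_(t : {ffun K -> {perm T}}) \sum_(f in perm_family S) G (conj_family f t))%N.
  rewrite -cM -sum_nat_const; apply: eq_bigr => t _.
  rewrite (reindex_inj (h := fun f => conj_family f t)) /=; last first.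
    move=> f f' /ffunP E; apply/ffunP => r; have := E r; rewrite !ffunE.
    exact: conjg_inj.
  apply: eq_bigl => f; rewrite !inE; apply/forallP/forallP => fS r; have := fS r.
    by rewrite ffunE => /(SJ _ _ (t r)); rewrite -conjgM mulVg conjg1.
  by rewrite ffunE; exact: SJ.
rewrite exchange_big /= mulnCA mulnA [X in (_ <= X)%N]mulnC -sum_nat_const.
by apply: leq_sum => f fS; exact: GC.
Qed.
End CycleAverages.

(** * Integer powers *)

Section IntegerPowers.
Import mathcomp.boot.fintype mathcomp.boot.finset.

(** Powers of the inverse: [perm_matrix] turns products in the group of
    permutations, where the left factor acts first, into reversed products of
    matrices, and [perm_matrixE] corrects this by an inverse. *)
Definition inv_zpow (T : finType) (s : {perm T}) (n : int) : {perm T} :=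
  match n with Posz m => (s^-1 ^+ m)%g | Negz m => (s ^+ m.+1)%g end.

Lemma intS_addr (n : nat) : Posz n + 1 = Posz n.+1.
Proof. by rewrite addrC -intS. Qed.

Lemma inv_zpowS (T : finType) (s : {perm T}) n :
  inv_zpow s (n + 1) = (inv_zpow s n * s^-1)%g.
Proof.
case: n => [n|[|n]].
  - by rewrite intS_addr /= expgSr.
  - by rewrite /= expg1 mulgV.
have -> : Negz n.+1 + 1 = Negz n by rewrite !NegzE; lia.
by rewrite /= [in RHS]expgSr mulgK.
Qed.

Lemma inv_zpowD (T : finType) (s : {perm T}) n k :
  inv_zpow s (n + k) = (inv_zpow s n * inv_zpow s k)%g.
Proof.
have pred m : inv_zpow s (m - 1) = (inv_zpow s m * s)%g.
  by have := inv_zpowS s (m - 1); rewrite subrK => ->; rewrite mulgKV.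
elim/int_rect: k => [|k IH|k IH]; first by rewrite addr0 mulg1.
  by rewrite -addn1 PoszD addrA !inv_zpowS IH mulgA.
have -> : - (k.+1 : int) = - k%:Z - 1 by lia.
by rewrite addrA !pred IH mulgA.
Qed.

Lemma inv_zpowJ (T : finType) (s t : {perm T}) n :
  inv_zpow (s ^ t)%g n = (inv_zpow s n ^ t)%g.
Proof. by case: n => n /=; rewrite ?conjXg ?conjVg. Qed.

Lemma unitary_powS (R : realType) (A : starAlgType R) (u : A) n : unitary u ->
  unitary_pow u (n + 1) = unitary_pow u n * u.
Proof.
move=> [uV Vu]; case: n => [n|[|n]].
  - by rewrite intS_addr /= exprSr.
  - by rewrite /= expr1 uV.
have -> : Negz n.+1 + 1 = Negz n by rewrite !NegzE; lia.
by rewrite /= [in RHS]exprSr -mulrA uV mulr1.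
Qed.

Lemma unitary_powD (R : realType) (A : starAlgType R) (u : A) n k : unitary u ->
  unitary_pow u (n + k) = unitary_pow u n * unitary_pow u k.
Proof.
move=> uU; have [uV Vu] := uU.
have pred m : unitary_pow u (m - 1) = unitary_pow u m * star u.
  by have := unitary_powS (m - 1) uU; rewrite subrK => ->; rewrite -mulrA Vu mulr1.
elim/int_rect: k => [|k IH|k IH]; first by rewrite addr0 mulr1.
  by rewrite -addn1 PoszD addrA !unitary_powS // IH mulrA.
have -> : - (k.+1 : int) = - k%:Z - 1 by lia.
by rewrite addrA !pred IH mulrA.
Qed.

End IntegerPowers.

(** * Words in random permutations *)

Section Words.
Import mathcomp.boot.fintype mathcomp.boot.finset.
Variables (R : realType) (K : finType) (N : nat -> nat).
Variable S : forall k, K -> {set 'S_(N k)}.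
Hypothesis N_gt0 : forall k, (0 < N k)%N.
Hypothesis SJ : forall k r s t, s \in S k r -> (s ^ t)%g \in S k r.
Hypothesis S_neq0 : forall k r, S k r != finset.set0.

(** [small] stands for the sequences that tend to 0, or for those that are
    absolutely summable. *)
Variable small : (nat -> R) -> Prop.
Hypothesis smallD : forall v w, small v -> small w -> small (fun k => v k + w k).
Hypothesis small_le : forall v w C, (forall k, 0 <= v k <= C * w k) -> small w -> small v.
Hypothesis smallN : small (fun k => ((N k)%:R ^+ 2)^-1).

(** An observable is meant to be a number of points among the N k. *)
Definition observable := forall k, {ffun K -> 'S_(N k)} -> nat.
Implicit Types X Y : observable.

Definition mean_sqr X k : R :=
  (\sum_(f in perm_family (S k)) X k f ^ 2)%:R / (#|perm_family (S k)| * N k ^ 2)%:R.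

Definition l2_small X := small (mean_sqr X).

Lemma perm_family_gt0 k : (0 < #|perm_family (S k)|)%N.
Proof.
rewrite card_perm_family prodn_gt0 // => r; rewrite card_gt0; exact: S_neq0.
Qed.

Lemma mean_sqr_ge0 X k : 0 <= mean_sqr X k.
Proof. by rewrite divr_ge0. Qed.

Lemma l2_small_le X Y : (forall k f, (X k f <= Y k f)%N) -> l2_small Y -> l2_small X.
Proof.
move=> XY; apply: (@small_le _ _ 1) => k; rewrite mean_sqr_ge0 mul1r ler_wpM2r ?invr_ge0 //.
by rewrite ler_nat; apply: leq_sum => f _; rewrite leq_sqr.
Qed.

Lemma l2_smallD X Y : l2_small X -> l2_small Y -> l2_small (fun k f => X k f + Y k f)%N.
Proof.
move=> nX nY; apply: (@small_le _ (fun k => mean_sqr X k + mean_sqr Y k) 2); last exact: smallD.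
move=> k; rewrite mean_sqr_ge0 -mulrDl mulrA ler_wpM2r ?invr_ge0 //.
rewrite -natrD -natrM ler_nat -big_split /= big_distrr /=; apply: leq_sum => f _.
by have [C _] := nat_Cauchy (X k f) (Y k f); rewrite sqrnD; lia.
Qed.

Lemma l2_small_bounded X C :
  (forall k, \sum_(f in perm_family (S k)) X k f ^ 2 <= C * #|perm_family (S k)|)%N -> l2_small X.
Proof.
move=> XC; apply: (@small_le _ _ C%:R) smallN => k; rewrite mean_sqr_ge0 /=.
have P0 := perm_family_gt0 k; have N0 := N_gt0 k.
rewrite ler_pdivrMr ?ltr0n ?muln_gt0 ?P0 ?expn_gt0 ?N0 //.
have Nn0 : (N k)%:R != 0 :> R by rewrite pnatr_eq0 -lt0n.
suff -> : C%:R * ((N k)%:R ^+ 2)^-1 * (#|perm_family (S k)| * N k ^ 2)%:R =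
    (C * #|perm_family (S k)|)%:R :> R by rewrite ler_nat.
by rewrite !natrM; field.
Qed.

Lemma l2_small0 : l2_small (fun k f => 0%N).
Proof. by apply: (@l2_small_bounded _ 0) => k; rewrite big1. Qed.

Lemma l2_small_sum (I : finType) (X : I -> observable) :
  (forall i, l2_small (X i)) -> l2_small (fun k f => \sum_i X i k f)%N.
Proof.
move=> nX; have : l2_small (fun k f => \sum_(i <- enum I) X i k f)%N.
  elim: (enum I) => [|i l IH].
    by apply: l2_small_le l2_small0 => k f; rewrite big_nil.
  apply: l2_small_le (l2_smallD (nX i) IH) => k f; by rewrite big_cons.
by apply: l2_small_le => k f; rewrite big_enum.
Qed.

(** [triv r n] means that the supremum d_r of the allowed lengths divides n (that
    n = 0 if it is infinite). *)
Variable triv : K -> int -> bool.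
Hypothesis moved_small : forall r n, triv r n -> l2_small (fun k f => nmoved (inv_zpow (f r) n)).
Hypothesis fix_small : forall r n, ~~ triv r n -> l2_small (fun k f => nfix (inv_zpow (f r) n)).

Implicit Types w : seq (K * int).
Definition perm_word k (f : {ffun K -> 'S_(N k)}) w : 'S_(N k) :=
  (\prod_(p <- w) inv_zpow (f p.1) p.2)%g.

(** Two words are close if they seldom act differently on a point. *)
Definition close w w' :=
  l2_small (fun k f => #|[set x | perm_word f w x != perm_word f w' x]|).

Lemma close_trans w1 w2 w3 : close w1 w2 -> close w2 w3 -> close w1 w3.
Proof.
move=> c12 c23; apply: l2_small_le (l2_smallD c12 c23) => k f.
apply: leq_trans (leq_card_setU _ _); apply/subset_leq_card/subsetP => x; rewrite !inE.
by case: (eqVneq (perm_word f w1 x) (perm_word f w2 x)) => [->|].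
Qed.

Lemma close_eq w w' : (forall k (f : {ffun K -> 'S_(N k)}), perm_word f w = perm_word f w') -> close w w'.
Proof.
move=> ww; apply: l2_small_le l2_small0 => k f.
by rewrite leqn0 cards_eq0; apply/eqP/setP => x; rewrite !inE ww eqxx.
Qed.

Lemma close_cons p w w' : close w w' -> close (p :: w) (p :: w').
Proof.
apply: l2_small_le => k f; rewrite /perm_word; under eq_finset do rewrite !big_cons !permM.
rewrite -(card_imset _ (@perm_inj _ (inv_zpow (f p.1) p.2))).
apply/subset_leq_card/subsetP => _ /imsetP[x xP ->]; by move: xP; rewrite !inE.
Qed.

Lemma close_drop r n w : triv r n -> close ((r, n) :: w) w.
Proof.
move=> rn; apply: l2_small_le (moved_small rn) => k f.
apply/subset_leq_card/subsetP => x; rewrite !inE /perm_word big_cons permM /=.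
by apply: contraNN => /eqP ->.
Qed.

Lemma nfix_close w w' : close w w' ->
  l2_small (fun k f => nfix (perm_word f w')) -> l2_small (fun k f => nfix (perm_word f w)).
Proof.
move=> cw nw'; apply: l2_small_le (l2_smallD cw nw') => k f.
apply: leq_trans (leq_card_setU _ _); apply/subset_leq_card/subsetP => x; rewrite !inE => /eqP ->.
by rewrite eq_sym orbC orbN.
Qed.

Definition reduced w := sorted (fun p q => p.1 != q.1) w && all (fun p => ~~ triv p.1 p.2) w.

(** If neighbours have distinct colours even around the end of the word, the
    bound on loopless walks applies. *)
Lemma cyclic_word_small w p : all (fun p => ~~ triv p.1 p.2) (p :: w) ->
  path (fun p q => p.1 != q.1) p w -> (last p w).1 != p.1 ->
  l2_small (fun k f => nfix (perm_word f (p :: w))).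
Proof.
move=> /allP ntriv alt cyc; set v := p :: w; pose m := size v.
pose c (i : 'I_m) := (nth p v i).1; pose e (i : 'I_m) := (nth p v i).2.
pose h k (f : {ffun K -> 'S_(N k)}) i := inv_zpow (f (c i)) (e i).
have c_alt i : c (ordS i) != c i.
  rewrite /c /=; have [ni|ni] := ltnP i.+1 m.
    by rewrite modn_small // eq_sym; have /pathP := alt; move=> /(_ p i); apply.
  have -> : i.+1 = m by apply/eqP; rewrite eqn_leq ni ltn_ord.
  have Ei : i = size w :> nat by have := ltn_ord i; rewrite /m /= in ni *; lia.
  by rewrite modnn /= Ei eq_sym -last_nth.
have nX : l2_small (fun k f => #|[set y | loopless_walk (h k f) y]|).
  apply: (@l2_small_bounded _ ((2 * m) ^ (2 * m) * ((2 * (2 * m)) ^ (2 * (2 * m))) ^ #|K|)) => k.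
  apply: sum_perm_family_conj => [r s t|f fS]; first exact: SJ.
  have x0 : 'I_(N k) := Ordinal (N_gt0 k).
  rewrite -mulnA -expnMn.
  apply: leq_trans (sum_loopless_sqr x0 (h k f) c_alt); apply: leq_sum => t _.
  rewrite leq_sqr; apply/subset_leq_card/subsetP => y; rewrite !inE.
  by move=> /forallP H; apply/forallP => i; move: (H i); rewrite /h ffunE inv_zpowJ.
have nF : l2_small (fun k f => \sum_i nfix (h k f i))%N.
  apply: l2_small_sum => i; apply: fix_small; apply: ntriv.
  exact: mem_nth.
apply: l2_small_le (l2_smallD nF nX) => k f; apply: leq_trans (nfix_prod _ _) => //.
rewrite /perm_word (big_nth p) big_mkord; exact: leqnn.
Qed.

Lemma nfix_mulC T (s t : {perm T}) : nfix (s * t)%g = nfix (t * s)%g.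
Proof.
rewrite /nfix -(card_imset _ (@perm_inj _ s)); apply: eq_card => x; rewrite !inE permM.
apply/imsetP/eqP => [[y] |tx].
  by rewrite inE permM => /eqP yP ->; rewrite yP.
by exists (t x); rewrite ?tx // inE permM tx.
Qed.

(** When the first and the last syllable have the same colour, conjugating by the
    last one merges them.  If the merged power is trivial it is dropped, and in
    any case the word gets shorter. *)
Lemma reduced_small w : reduced w -> w != [::] ->
  l2_small (fun k f => nfix (perm_word f w)).
Proof.
elim: {w}_.+1 {-2}w (ltnSn (size w)) => // n IH w; rewrite ltnS.
case: w => // p w; rewrite /reduced /= => wn /andP[alt ntriv] _.
case: (eqVneq (last p w).1 p.1) => [cyc|]; last exact: cyclic_word_small.
case: (lastP w) => [|v q] in wn alt ntriv cyc *.
  move: ntriv; rewrite andbT => /fix_small; apply: l2_small_le => k f.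
  by rewrite /perm_word big_seq1.
rewrite last_rcons in cyc; case: p q cyc wn alt ntriv => r n1 [_ n2] /= -> wn alt ntriv.
have [vne altv] : v != [::] /\ path (fun p q : K * int => p.1 != q.1) (r, 0) v.
  case: v {wn ntriv} alt => [|v0 v] /=; first by rewrite eqxx.
  by rewrite rcons_path => /andP[-> /andP[->]].
have ntrivv : all (fun p => ~~ triv p.1 p.2) v.
  by move: ntriv; rewrite all_rcons => /andP[_ /andP[_]].
have rot k (f : {ffun K -> 'S_(N k)}) : nfix (perm_word f ((r, n1) :: rcons v (r, n2))) =
    nfix (perm_word f ((r, n2 + n1) :: v)).
  by rewrite /perm_word !big_cons -cats1 big_cat big_seq1 /= mulgA [LHS]nfix_mulC inv_zpowD !mulgA.
have vn : ((size v).+1 < n)%N by move: wn; rewrite size_rcons; lia.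
suff : l2_small (fun k f => nfix (perm_word f ((r, n2 + n1) :: v))).
  by move=> H; apply: l2_small_le H => k f; rewrite rot.
case: (boolP (triv r (n2 + n1))) => tr.
  apply: nfix_close (close_drop _ tr) _; apply: IH => //; first exact: ltnW.
  rewrite /reduced ntrivv andbT.
  exact: path_sorted altv.
apply: IH => //; apply/andP; split; last by apply/andP.
by move: altv; case: (v).
Qed.

Variables (A : starAlgType R) (u : K -> A).
Hypothesis uU : forall r, unitary (u r).
Hypothesis u_triv : forall r n, triv r n -> unitary_pow (u r) n = 1.

Definition alg_word w := \prod_(p <- w) unitary_pow (u p.1) p.2.

Lemma word_reduction w : exists w',
  [/\ reduced w', alg_word w = alg_word w' & close w w'].
Proof.
elim: w => [|[r n] w [w' [red' Aw cw]]]; first by exists [::]; split=> //; exact: close_eq.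
have Acons : alg_word ((r, n) :: w) = unitary_pow (u r) n * alg_word w'.
  by rewrite /alg_word big_cons -/(alg_word w) Aw.
have ccons := close_cons (r, n) cw.
case: (boolP (triv r n)) => tr.
  exists w'; split=> //; first by rewrite Acons u_triv ?mul1r.
  exact: close_trans ccons (close_drop _ tr).
case: w' => [|[r' n'] w'] in red' Aw cw Acons ccons *.
  exists [:: (r, n)]; split=> //; first by rewrite /reduced /= tr.
  by rewrite Acons /alg_word big_seq1 big_nil mulr1.
case: (eqVneq r r') => [rr'|rr']; last first.
  exists [:: (r, n), (r', n') & w']; split=> //.
    by move: red'; rewrite /reduced /= rr' tr.
  by rewrite Acons [RHS]/alg_word [RHS]big_cons.
rewrite -{}rr' in red' Aw cw Acons ccons.
have merge : close ((r, n) :: w) ((r, n + n') :: w').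
  apply: close_trans ccons _; apply: close_eq => k f.
  by rewrite /perm_word !big_cons /= inv_zpowD mulgA.
have Amerge : alg_word ((r, n) :: w) = alg_word ((r, n + n') :: w').
  by rewrite Acons /alg_word !big_cons /= unitary_powD // mulrA.
move: red'; rewrite /reduced /= => /and3P[alt _ ntriv].
case: (boolP (triv r (n + n'))) => tr'.
  exists w'; split; first by rewrite ntriv andbT; exact: path_sorted alt.
    by rewrite Amerge /alg_word big_cons u_triv ?mul1r.
  exact: close_trans merge (close_drop _ tr').
exists ((r, n + n') :: w'); split=> //; apply/andP; split; last by apply/andP.
by move: alt; case: (w').
Qed.

Variable phi : {scalar A}.
Hypothesis phi1 : phi 1 = 1.
Hypothesis phi_free : star_free phi u.
Hypothesis phi_triv : forall r n, ~~ triv r n -> phi (unitary_pow (u r) n) = 0.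

Lemma star_generated_pow (a : A) n : star_generated a (unitary_pow a n).
Proof.
move=> B [[B1 BZ BM Bstar] aB].
have Ba : B a by apply: aB.
have BX b m : B b -> B (b ^+ m).
  by move=> Bb; elim: m => [|m IH]; rewrite ?expr0 // exprS; exact: BM.
by case: n => n; apply: BX => //; exact: Bstar.
Qed.

(** This is freeness: the syllables are centred elements of alternating
    subalgebras. *)
Lemma phi_reduced w : reduced w -> w != [::] -> phi (alg_word w) = 0.
Proof.
case: w => // p w; set v := p :: w => /andP[alt /allP ntriv] _.
rewrite /alg_word (big_nth p) big_mkord.
apply: (phi_free (j := fun i : 'I_(size v) => (nth p v i).1)) => //.
- move=> i j ij; have := pathP p alt i; rewrite -/v => H.
  have iw : (i < size w)%N by have := ltn_ord j; rewrite ij.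
  by have := H iw; rewrite ij /= => /eqP.
- by move=> i; exact: star_generated_pow.
- by move=> i; apply: phi_triv; apply: ntriv; exact: mem_nth.
Qed.

Lemma word_dichotomy w :
  (phi (alg_word w) = 1 /\ l2_small (fun k f => nmoved (perm_word f w))) \/
  (phi (alg_word w) = 0 /\ l2_small (fun k f => nfix (perm_word f w))).
Proof.
have [w' [red' Aw cw]] := word_reduction w; rewrite Aw.
case: (eqVneq w' [::]) => [w0|w0]; last first.
  right; split; first exact: phi_reduced.
  by apply: nfix_close cw _; exact: reduced_small.
left; rewrite w0 /alg_word big_nil phi1; split=> //.
apply: l2_small_le cw => k f; rewrite w0.
by apply/subset_leq_card/subsetP => x; rewrite !inE /perm_word big_nil perm1.
Qed.
End Words.

(** * Powers of one permutation *)

Section PorbitFacts.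
Import mathcomp.boot.fintype mathcomp.boot.finset.
Variable T : finType.
Implicit Types (s t : {perm T}).

Lemma porbitJ s t x : porbit (s ^ t)%g (t x) = t @: porbit s x.
Proof.
apply/setP => y; apply/porbitP/imsetP => [[k ->]|[z /porbitP[k ->] ->]].
  by exists ((s ^+ k)%g x); [exact: mem_porbit | rewrite -conjXg permJ].
by exists k; rewrite -conjXg permJ.
Qed.

Lemma cycle_permsJ A s t : s \in cycle_perms [set: T] A -> (s ^ t)%g \in cycle_perms [set: T] A.
Proof.
rewrite !inE => /andP[_ /forall_inP sA]; apply/andP; split.
  by apply/subsetP => x _; rewrite inE.
apply/forall_inP => x _; rewrite -(permKV t x) porbitJ card_imset; last exact: perm_inj.
by apply: sA; rewrite inE.
Qed.

Lemma perm_expg_fix s x n : ((s ^+ n)%g x == x) = (#|porbit s x| %| n)%N.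
Proof.
set p := #|porbit s x|; have p0 : (0 < p)%N by rewrite lt0n card_porbit_neq0.
have sp : (s ^+ p)%g x = x by rewrite permX iter_porbit.
have spk k : (s ^+ (k * p))%g x = x.
  by elim: k => [|k IH]; rewrite ?mul0n ?expg0 ?perm1 // mulSn expgD permM sp.
have E : (s ^+ n)%g x = (s ^+ (n %% p))%g x.
  by rewrite {1}(divn_eq n p) expgD permM spk.
rewrite E /dvdn; have rp : (n %% p < p)%N by rewrite ltn_mod.
have := uniq_traject_porbit s x; rewrite -/p.
have nt k : (k < p)%N -> nth x (traject s x p) k = (s ^+ k)%g x.
  by move=> kp; rewrite nth_traject // permX.
move=> U; rewrite -nt //.
rewrite -[X in _ == X](perm1 x) -(expg0 s) -nt //.
by rewrite nth_uniq // size_traject.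
Qed.

Lemma inv_zpow_fix s n x : (inv_zpow s n x == x) = (#|porbit s x| %| `|n|)%N.
Proof.
case: n => n /=; last by rewrite perm_expg_fix.
by rewrite perm_expg_fix porbitV.
Qed.

End PorbitFacts.

Section CycleEstimates.
Import mathcomp.boot.fintype mathcomp.boot.finset.
Variables (R : realType).

Definition off_length_points (T : finType) d (s : {perm T}) := #|[set x | #|porbit s x| != d]|.

Lemma nmoved_le_off_length (T : finType) d (s : {perm T}) n :
  (d %| `|n|)%N -> (nmoved (inv_zpow s n) <= off_length_points d s)%N.
Proof.
move=> dn; apply/subset_leq_card/subsetP => x; rewrite !inE inv_zpow_fix.
by apply: contraNN => /eqP ->.
Qed.

Lemma nfix_le_off_length (T : finType) d (s : {perm T}) n :
  ~~ (d %| `|n|)%N -> (nfix (inv_zpow s n) <= off_length_points d s)%N.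
Proof.
move=> dn; apply/subset_leq_card/subsetP => x; rewrite !inE inv_zpow_fix.
by apply: contraTN => /eqP ->.
Qed.

(** The permutations with restricted cycle lengths form a positive proportion of
    all permutations once T has at least n1 points, so their second moment is at most a
    constant times the uniform one.  Smaller sets T only contribute a trivial
    bound, whence the maximum in the constant. *)
Lemma sum_nfix_bounded (A : pred nat) K n : n != 0 ->
  (forall m, \sum_(K <= j < m | ~~ A j) (j%:R^-1 : R) <= 2^-1) ->
  exists C, forall T : finType, cycle_perms [set: T] A != finset.set0 ->
    (\sum_(s in cycle_perms [set: T] A) nfix (inv_zpow s n) ^ 2 <=
     C * #|cycle_perms [set: T] A|)%N.
Proof.
move=> n0 /cycle_weight_lower[c c0 [n1 cP]].
have an : (0 < `|n|)%N by rewrite absz_gt0.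
have nz (T : finType) (s : {perm T}) : nfix (inv_zpow s n) = nfix (s ^+ `|n|%N)%g.
  by apply: eq_card => x; rewrite !inE inv_zpow_fix perm_expg_fix.
set B := ((2 * `|n|) ^ (2 * `|n|))%N.
exists (maxn (n1 ^ 2) (Num.trunc ((B * B)%:R / c)).+1) => T S0.
have [Tn|Tn] := ltnP #|T| n1.
  apply: (@leq_trans (n1 ^ 2 * #|cycle_perms [set: T] A|)); last by rewrite leq_mul2r leq_maxl orbT.
  rewrite mulnC -sum_nat_const; apply: leq_sum => s _; rewrite leq_sqr.
  by apply: leq_trans (max_card _) (ltnW Tn).
apply: (@leq_trans ((Num.trunc ((B * B)%:R / c)).+1 * #|cycle_perms [set: T] A|));
  last by rewrite leq_mul2r leq_maxr orbT.
apply: (@leq_trans (B * (B * #|T| `!))).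
  apply: leq_trans (sum_nfix_expg T an).
  rewrite big_mkcond; apply: leq_sum => s _; case: ifP => // _; by rewrite nz.
rewrite mulnA -(ler_nat R) [leRHS]natrM card_cycle_perms cardsT natrM.
rewrite mulrCA [leLHS]mulrC ler_wpM2l //.
have := cP _ Tn; set a := cycle_weight _ _ _ => ca.
apply: le_trans (_ : _ <= (B * B)%:R / c * a) _.
  by rewrite mulrAC ler_pdivlMr // ler_wpM2l.
rewrite ler_wpM2r ?cycle_weight_ge0 // ltW //; exact: truncnS_gt.
Qed.

End CycleEstimates.

(** * Sets of cycle lengths *)

Section CycleLengthSets.
Local Open Scope classical_set_scope.
Variable R : realType.

Lemma esum_tail (A : set nat) :
  (\esum_(j in [set j | (0 < j)%N] `\` A) (j%:R^-1 : R)%:E < +oo)%E ->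
  exists K, forall m, \sum_(K <= j < m | j \notin A) (j%:R^-1 : R) <= 2^-1.
Proof.
move=> Afin; pose v j : R := if j \notin A then j%:R^-1 else 0.
have v0 j : 0 <= v j by rewrite /v; case: ifP.
set E := (\esum_(j in _) _)%E in Afin.
have E0 : (0 <= E)%E by apply: esum_ge0 => j _; rewrite lee_fin.
have vE n : \sum_(i < n) v i <= fine E.
  rewrite -lee_fin fineK; last by rewrite ge0_fin_numE.
  apply: esum_ge; exists [set` [seq j <- iota 0 n | (0 < j)%N && (j \notin A)]].
    split; first exact: finite_seq.
    move=> j /=; rewrite mem_filter => /andP[/andP[j0 jA] _]; split=> //.
    by move=> Aj; move/negP: jA; apply; exact/mem_set.
  rewrite -fsbig_seq ?filter_uniq ?iota_uniq // sumEFin lee_fin.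
  rewrite big_filter -(big_mkord xpredT v) /index_iota subn0.
  rewrite [leRHS]big_mkcond /=; apply: ler_sum => j _; rewrite /v.
  by case: posnP => [->|_] /=; rewrite ?invr0 ?if_same.
have [K KP] := bounded_series_tail v0 vE (e := 2^-1) ltac:(by rewrite invr_gt0).
exists K => m; rewrite big_mkcond /=; have [Km|mK] := leqP K m; first by apply: KP; rewrite leqnn.
by rewrite big_geq ?invr_ge0 // ltnW.
Qed.

Lemma sup_nat_finite (A : set nat) : A !=set0 -> finite_set A ->
  exists d, [/\ sup_nat A = Some d, A d & forall j, A j -> (j <= d)%N].
Proof.
move=> [a Aa] Afin.
have [n An] : exists n, forall j, A j -> (j <= n)%N.
  have /finite_seqP[s ->] := Afin.
  exists (\max_(i <- s) i) => j /= js; exact: leq_bigmax_seq.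
have exA : exists j, j \in A by exists a; exact/mem_set.
have ubA j : j \in A -> (j <= n)%N by move=> /set_mem; exact: An.
pose d := ex_maxn exA ubA; have [/set_mem Ad dmax] : d \in A /\ forall j, j \in A -> (j <= d)%N.
  by rewrite /d; case: ex_maxnP.
have dub : ubound A d by move=> j Aj; apply: dmax; exact/mem_set.
exists d; split=> //.
rewrite /sup_nat; case: asboolP => [_|nub]; last by case: nub; exists d.
congr Some; rewrite /supremum; case: eqP => [A0|_]; first by move: Aa; rewrite A0.
have dsup : supremums A d by split=> // x xA; apply: xA.
by case: xgetP => [y _ ysup|/(_ d)//]; apply: is_subset1_supremums ysup dsup.
Qed.

Lemma sup_nat_infinite (A : set nat) : ~ finite_set A -> sup_nat A = None.
Proof.
move=> Ainf; rewrite /sup_nat; case: asboolP => // -[n An]; case: Ainf.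
apply: (sub_finite_set (B := `I_n.+1)); last exact: finite_II.
by move=> j /An; rewrite /= ltnS.
Qed.
End CycleLengthSets.

(** * Points off the longest cycles *)

Section OffLengthMean.
Variables (R : realType) (K : finType) (N : nat -> nat).
Variable S : forall k, K -> {set 'S_(N k)}.
Hypothesis S_neq0 : forall k r, S k r != finset.set0.
Hypothesis N_ge : forall k, (k < N k)%N.

(** The square of a proportion is at most the proportion, so the mean suffices;
    [sum_short_cycles] bounds it by d / m + O(1 / N k) for every m. *)
Lemma off_length_mean_cvg (r : K) (A : pred nat) d :
  (forall k, S k r = cycle_perms [set: 'I_(N k)] A) ->
  A d -> (forall j, A j -> (j <= d)%N) ->
  (mean_sqr R S (fun k f => off_length_points d (f r)) @ \oo --> (0 : R))%classic.
Proof.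
move=> SA Ad Amax.
pose B m n := (d * (d * d + (n %/ m).+1 + m ^ d.-1))%N.
have bound m k : (0 < m)%N -> (d * d <= N k)%N ->
    mean_sqr R S (fun k f => off_length_points d (f r)) k <= (B m (N k))%:R / (N k)%:R.
  move=> m0 dN; have N0 : (0 < N k)%N by apply: leq_trans (N_ge k).
  have P0 := perm_family_gt0 S_neq0 k.
  have Sr0 : (0 < #|S k r|)%N by rewrite finset.card_gt0.
  have sumZ : (\sum_(f in perm_family (S k)) off_length_points d (f r))%:R <=
      (B m (N k))%:R * #|perm_family (S k)|%:R :> R.
    rewrite -(ler_pM2r (_ : 0 < #|S k r|%:R)) ?ltr0n // -[leLHS]natrM big_distrl /=.
    rewrite sum_marginal natrM mulrC mulrAC ler_wpM2r //.
    have := @sum_short_cycles R 'I_(N k) A d m Ad Amax m0.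
    by rewrite card_ord -SA; apply.
  rewrite /mean_sqr ler_pdivrMr ?ltr0n ?muln_gt0 ?P0 ?expn_gt0 ?N0 //.
  apply: le_trans (_ : _ <= (N k)%:R * (\sum_(f in perm_family (S k)) off_length_points d (f r))%:R) _.
    rewrite -natrM ler_nat big_distrr /=; apply: leq_sum => f _.
    by rewrite -mulnn leq_mul2r; apply/orP; right; apply: leq_trans (max_card _) _; rewrite card_ord.
  apply: le_trans (ler_wpM2l _ sumZ) _ => //.
  have Nn0 : (N k)%:R != 0 :> R by rewrite pnatr_eq0 -lt0n.
  rewrite natrM natrX le_eqVlt; apply/orP; left; apply/eqP; field; exact: Nn0.
apply/cvgr0Pnorm_le => e e0.
pose m := (Num.trunc (2 * d%:R / e)).+1.
have mP : d%:R / m%:R <= e / 2.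
  have := truncnS_gt (2 * d%:R / e); rewrite -/m ltr_pdivrMr // => me.
  by rewrite ler_pdivrMr ?ltr0n //; lra.
pose c := (d * (d * d + 1 + m ^ d.-1))%N.
pose n0 := (Num.trunc (2 * c%:R / e)).+1.
exists (maxn n0 (d * d)) => // k /= kn.
have N0 : (0 < N k)%N by apply: leq_trans (N_ge k).
rewrite ger0_norm ?mean_sqr_ge0 //; apply: le_trans (bound m k isT _) _.
  by have := N_ge k; move: kn; rewrite geq_max; lia.
rewrite ler_pdivrMr ?ltr0n //.
have BE : (B m (N k))%:R <= c%:R + d%:R * ((N k)%:R / m%:R) :> R.
  have -> : B m (N k) = (c + d * (N k %/ m))%N by rewrite /B /c; nia.
  rewrite natrD natrM lerD2l ler_wpM2l // ler_pdivlMr ?ltr0n // -natrM ler_nat.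
  exact: leq_trunc_div.
apply: le_trans BE _.
have cN : c%:R <= e / 2 * (N k)%:R.
  have := truncnS_gt (2 * c%:R / e); rewrite -/n0 ltr_pdivrMr // => n0e.
  have : (n0%:R : R) <= (N k)%:R.
    by rewrite ler_nat; have := N_ge k; move: kn; rewrite geq_max; lia.
  by rewrite -(ler_pM2r e0); lra.
have dN : d%:R * ((N k)%:R / m%:R) <= e / 2 * (N k)%:R.
  by rewrite mulrCA mulrC ler_wpM2r.
have -> : e * (N k)%:R = e / 2 * (N k)%:R + e / 2 * (N k)%:R by lra.
exact: lerD.
Qed.
End OffLengthMean.

(** * Vanishing and summable sequences *)

Section Smallness.
Local Open Scope classical_set_scope.
Variables (R : realType) (N : nat -> nat).
Hypothesis N_ge : forall k, (k < N k)%N.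
Implicit Types v w : nat -> R.

Definition vanishing v := v @ \oo --> (0 : R).
Definition summable_seq v := exists M, forall n, \sum_(k < n) `|v k| <= M.

Lemma vanishingD v w : vanishing v -> vanishing w -> vanishing (fun k => v k + w k).
Proof. by move=> v0 w0; rewrite /vanishing -[X in _ --> X]addr0; exact: cvgD. Qed.

Lemma vanishing_le v w C : (forall k, 0 <= v k <= C * w k) -> vanishing w -> vanishing v.
Proof.
move=> vw w0; apply: (@squeeze_cvgr _ _ _ _ (cst 0) (fun k => C * w k)).
- by near=> k; exact: vw.
- exact: cvg_cst.
- by rewrite -[X in _ --> X](mulr0 C); apply: cvgMr.
Unshelve. all: by end_near. Qed.

Lemma inv_sqr_le k : ((N k)%:R ^+ 2)^-1 <= (k.+1%:R ^+ 2)^-1 :> R.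
Proof.
have N0 : (0 < N k)%N by apply: leq_trans (N_ge k).
by rewrite lef_pV2 ?posrE ?exprn_gt0 ?ltr0n // ler_pXn2r ?nnegrE ?ler0n // ler_nat.
Qed.

Lemma vanishing_inv_sqr : vanishing (fun k => ((N k)%:R ^+ 2)^-1).
Proof.
apply: (@vanishing_le _ (fun k => k.+1%:R^-1) 1); last exact: cvg_harmonic.
move=> k; rewrite invr_ge0 exprn_ge0 //= mul1r; apply: le_trans (inv_sqr_le k) _.
by rewrite lef_pV2 ?posrE ?exprn_gt0 ?ltr0n // expr2 ler_peMl ?ler0n // ler1n.
Qed.

Lemma summableD v w : summable_seq v -> summable_seq w -> summable_seq (fun k => v k + w k).
Proof.
move=> [M vM] [L wL]; exists (M + L) => n; apply: le_trans (lerD (vM n) (wL n)).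
by rewrite -big_split; apply: ler_sum => k _; exact: ler_normD.
Qed.

Lemma summable_le v w C : (forall k, 0 <= v k <= C * w k) -> summable_seq w -> summable_seq v.
Proof.
move=> vw [M wM]; exists (`|C| * M) => n; apply: le_trans (ler_wpM2l _ (wM n)) => //.
rewrite mulr_sumr; apply: ler_sum => k _; have /andP[v0 vC] := vw k.
by rewrite ger0_norm // -normrM (le_trans vC) // ler_norm.
Qed.

Lemma summable_inv_sqr : summable_seq (fun k => ((N k)%:R ^+ 2)^-1).
Proof.
have H n : \sum_(k < n.+1) (k.+1%:R ^+ 2)^-1 <= 2 - n.+1%:R^-1 :> R.
  elim: n => [|n IH]; first by rewrite big_ord_recr big_ord0 /= expr1n invr1; lra.
  rewrite big_ord_recr /=; apply: le_trans (lerD IH (lexx _)) _.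
  have n1 : n.+1%:R != 0 :> R by rewrite pnatr_eq0.
  have n2 : n.+2%:R != 0 :> R by rewrite pnatr_eq0.
  have E : n.+1%:R^-1 - n.+2%:R^-1 = n.+1%:R^-1 * n.+2%:R^-1 :> R.
    have -> : n.+2%:R = n.+1%:R + 1 :> R by rewrite -natr1.
    have x0 : 0 < n.+1%:R :> R by rewrite ltr0n.
    move: (n.+1%:R) x0 => x x0; field.
    by rewrite !gt_eqF // addr_gt0.
  have : n.+2%:R^-1 * n.+2%:R^-1 <= n.+1%:R^-1 * n.+2%:R^-1 :> R.
    by rewrite ler_wpM2r // lef_pV2 ?posrE ?ltr0n // ler_nat.
  rewrite expr2 invfM; move: (n.+1%:R^-1) (n.+2%:R^-1) E => a b; lra.
exists 2 => n; apply: le_trans (_ : _ <= \sum_(k < n) (k.+1%:R ^+ 2)^-1) _.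
  by apply: ler_sum => k _; rewrite ger0_norm ?inv_sqr_le // invr_ge0 exprn_ge0.
case: n => [|n]; first by rewrite big_ord0.
by apply: le_trans (H n) _; rewrite gerBl invr_ge0.
Qed.
End Smallness.

(** * Words in permutations with restricted cycle lengths *)

Section CycleWords.
Variables (R : realType) (s : nat) (A : 'I_s -> set nat) (N : nat -> nat).
Variables (Alg : starAlgType R) (phi : {scalar Alg}) (u : 'I_s -> Alg).
Hypothesis A_neq0 : forall r, (A r !=set0)%classic.
Hypothesis A_tail : forall r, finite_set (A r) \/
  exists K, forall m, \sum_(K <= j < m | j \notin A r) (j%:R^-1 : R) <= 2^-1.
Hypothesis phi1 : phi 1 = 1.
Hypothesis u_free : star_free phi u.
Hypothesis u_haar : forall r, haar_unitary phi (sup_nat (A r)) (u r).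
Hypothesis N_ge : forall k, (k < N k)%N.

Let S k r := perms_with_cycles (N k) (A r).
Hypothesis S_neq0 : forall k r, S k r != finset.set0.

Variable small : (nat -> R) -> Prop.
Hypothesis smallD : forall v w, small v -> small w -> small (fun k => v k + w k).
Hypothesis small_le : forall v w C, (forall k, 0 <= v k <= C * w k) -> small w -> small v.
Hypothesis smallN : small (fun k => ((N k)%:R ^+ 2)^-1).
Hypothesis small_off_length : forall r d, finite_set (A r) -> sup_nat (A r) = Some d ->
  l2_small S small (fun k f => off_length_points d (f r)).

Let N_gt0 k : (0 < N k)%N. Proof. exact: leq_trans (N_ge k). Qed.

Definition trivial_power r (n : int) : bool :=
  match sup_nat (A r) with Some m => (m%:Z %| n)%Z | None => n == 0 end.

Lemma marginal_l2_small r (F : forall k, 'S_(N k) -> nat) C :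
  (forall k, \sum_(t in S k r) F k t ^ 2 <= C * #|S k r|)%N ->
  l2_small S small (fun k f => F k (f r)).
Proof.
move=> FC; apply: (l2_small_bounded N_gt0 S_neq0 small_le smallN (C := C)) => k.
have Sr0 : (0 < #|S k r|)%N by rewrite finset.card_gt0.
rewrite -(leq_pmul2r Sr0) big_distrl /= (sum_marginal (S k) (fun t => F k t ^ 2)%N).
apply: leq_trans (leq_mul (leqnn _) (FC k)) _.
by rewrite mulnA (mulnC #|perm_family (S k)| C).
Qed.

Lemma trivial_power_moved r n : trivial_power r n ->
  l2_small S small (fun k f => nmoved (inv_zpow (f r) n)).
Proof.
rewrite /trivial_power; have [Afin|Ainf] := pselect (finite_set (A r)).
  have [d [Ed Ad dmax]] := sup_nat_finite (@A_neq0 r) Afin.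
  rewrite Ed dvdzE /= => dn.
  apply: (l2_small_le small_le) (small_off_length Afin Ed) => k f.
  exact: nmoved_le_off_length.
rewrite sup_nat_infinite // => /eqP ->.
apply: (@marginal_l2_small r (fun k t => nmoved (inv_zpow t 0)) 0) => k.
rewrite big1 // => t _; rewrite /nmoved /= eq_card0 // => x.
by rewrite finset.inE perm1 eqxx.
Qed.

Lemma nontrivial_power_fix r n : ~~ trivial_power r n ->
  l2_small S small (fun k f => nfix (inv_zpow (f r) n)).
Proof.
rewrite /trivial_power; have [Afin|Ainf] := pselect (finite_set (A r)).
  have [d [Ed Ad dmax]] := sup_nat_finite (@A_neq0 r) Afin.
  rewrite Ed dvdzE /= => dn.
  apply: (l2_small_le small_le) (small_off_length Afin Ed) => k f.
  exact: nfix_le_off_length.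
rewrite sup_nat_infinite // => n0.
have [//|[M AM]] := A_tail r.
have [C CP] := sum_nfix_bounded n0 AM.
apply: (@marginal_l2_small r (fun k t => nfix (inv_zpow t n)) C) => k.
by rewrite /S perms_with_cyclesE; apply: CP; rewrite -perms_with_cyclesE; exact: S_neq0.
Qed.

Lemma cycle_word_dichotomy w :
  (phi (alg_word u w) = 1 /\ l2_small S small (fun k f => nmoved (perm_word f w))) \/
  (phi (alg_word u w) = 0 /\ l2_small S small (fun k f => nfix (perm_word f w))).
Proof.
have SJ k r t t' : t \in S k r -> (t ^ t')%g \in S k r.
  by rewrite /S perms_with_cyclesE; exact: cycle_permsJ.
apply: (word_dichotomy N_gt0 SJ S_neq0 smallD small_le smallN trivial_power_moved
   nontrivial_power_fix _ _ phi1 u_free).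
- by move=> r; have [] := u_haar r.
- move=> r n; rewrite /trivial_power; have [uU] := u_haar r.
  case: (sup_nat (A r)) => [d [ud _]|_]; last by move=> /eqP ->; rewrite /= expr0.
  move=> /dvdzP[q ->].
  have dpow (q' : nat) : unitary_pow (u r) (q'%:Z * d%:Z) = 1.
    by rewrite -PoszM /= mulnC exprM ud expr1n.
  case: q => q' //; have := unitary_powD (Negz q' * d) (q'.+1%:Z * d%:Z) uU.
  by rewrite dpow mulr1 -mulrDl NegzE addNr mul0r /= expr0.
- move=> r n; rewrite /trivial_power; have [uU] := u_haar r.
  by case: (sup_nat (A r)) => [d [_ H]|H] /H.
Qed.
End CycleWords.

(** * Words in permutation matrices *)

Section MatrixWords.
Variables (R : realType).

Definition letter_word s n (r : 'I_n -> 'I_s) (e : 'I_n -> bool) : seq ('I_s * int) :=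
  [seq (r i, if e i then -1 else 1) | i <- index_enum 'I_n].

Lemma star_moment_word (A : starAlgType R) (phi : {scalar A}) s (u : 'I_s -> A) n
    (r : 'I_n -> 'I_s) e :
  star_moment phi u r e = phi (alg_word u (letter_word r e)).
Proof.
rewrite /star_moment /alg_word /letter_word big_map; congr (phi _).
by apply: eq_bigr => i _; rewrite /star_if; case: (e i); rewrite /= expr1.
Qed.

Lemma perm_matrixE N (s : 'S_N) : perm_matrix R s = perm_mx (s^-1)%g.
Proof.
apply/matrixP => i j; rewrite !mxE; congr (nat_of_bool _)%:R.
by apply/eqP/eqP => [<-|<-]; rewrite ?permK ?permKV.
Qed.

Lemma perm_matrix_inj N : injective (@perm_matrix R N).
Proof.
move=> s t /matrixP E; apply/permP => j; apply/eqP; rewrite eq_sym.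
by have := E (s j) j; rewrite !mxE eqxx; case: eqP => // _ /eqP; rewrite oner_eq0.
Qed.

Lemma adj_perm_matrix N (s : 'S_N) : adj_if true (perm_matrix R s) = perm_mx s.
Proof.
by apply/matrixP => i j; rewrite /adj_if !mxE rmorph_nat.
Qed.

Lemma ntr_perm_mx N (s : 'S_N) :
  ntr (perm_mx s) = ((nfix s)%:R / N%:R)%:C%C :> R[i].
Proof.
rewrite /ntr /mxtrace.
have -> : \sum_i (perm_mx s : 'M[R[i]]_N) i i = (nfix s)%:R.
  rewrite /nfix -sum1_card natr_sum [RHS]big_mkcond /=; apply: eq_bigr => i _.
  by rewrite !mxE finset.inE; case: eqP.
by rewrite mulrC rmorphM fmorphV !rmorph_nat.
Qed.

Lemma matrix_moment_word N s (B : 'I_s -> 'M[R[i]]_N) (f : {ffun 'I_s -> 'S_N}) n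
    (r : 'I_n -> 'I_s) e :
  (forall q, B q = perm_matrix R (f q)) ->
  matrix_moment B r e =
    ((nfix (@perm_word _ (fun=> N) 0 f (letter_word r e)))%:R / N%:R)%:C%C.
Proof.
move=> BE; rewrite /matrix_moment -ntr_perm_mx; congr ntr.
rewrite /perm_word /letter_word big_map /=.
rewrite (big_morph (@perm_mx R[i] N) (@perm_mxM _ _) (@perm_mx1 _ _)).
apply: eq_bigr => i _; rewrite BE; case: (e i).
  by rewrite adj_perm_matrix /= expg1.
by rewrite /adj_if perm_matrixE /= expg1.
Qed.
End MatrixWords.

(** * The law of the random permutations *)

Section Law.
Local Open Scope classical_set_scope.
Variables (R : realType) (d : measure_display) (Omega : measurableType d).
Variables (P : probability Omega R) (N s : nat) (S : 'I_s -> {set 'S_N}).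
Variable U : 'I_s -> Omega -> borel_mx R N.
Hypothesis U_perm : forall r, random_perm_matrix (U r).
Hypothesis U_unif : forall r, uniform_on P (S r) (U r).
Hypothesis U_indep : independent_family P U.

Lemma measurable_mx1 (M : 'M[R[i]]_N) : measurable ([set M] : set (borel_mx R N)).
Proof.
rewrite -[X in measurable X]setCK; apply: measurableC; apply: sub_sigma_algebra.
have -> : ~` [set M] = \bigcup_(p in [set: 'I_N * 'I_N])
    ((fun B : 'M[R[i]^o]_N => B p.1 p.2) @^-1` [set x | x != M p.1 p.2]).
  apply/seteqP; split=> [B /= BM|B [p _ /= Bp] BM]; last by rewrite BM eqxx in Bp.
  apply: contrapT => noB; apply: BM; apply/matrixP => i j; apply: contrapT => Bij.
  by apply: noB; exists (i, j) => //=; apply/eqP.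
apply: bigcup_open => p _; apply: open_comp; first by move=> B _; exact: coord_continuous.
have -> : [set x : R[i]^o | x != M p.1 p.2] = ~` [set (M p.1 p.2 : R[i]^o)].
  by apply/seteqP; split=> x /eqP.
by apply: closed_openC; apply: accessible_closed_set1; apply: hausdorff_accessible; exact: norm_hausdorff.
Qed.

(** The family of permutations read off the random matrices is uniformly
    distributed over the product of the given sets. *)
Lemma permutation_law : exists sg : Omega -> {ffun 'I_s -> 'S_N},
  [/\ forall w r, U r w = perm_matrix R (sg w r),
      forall w, sg w \in perm_family S,
      forall f, measurable [set w | sg w = f] &
      forall f, f \in perm_family S ->
        P [set w | sg w = f] = (#|perm_family S|%:R^-1)%:E].
Proof.
have sgP w r : exists t, t \in S r /\ U r w = perm_matrix R t.
  have [rangeU _] := U_unif r.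
  have : (@perm_matrix R N @` [set` S r]) (U r w) by rewrite -rangeU; exists w.
  by move=> [t tS <-]; exists t.
pose sg w := [ffun r => projT1 (cid (sgP w r))] : {ffun 'I_s -> 'S_N}.
have sgE w r : sg w r \in S r /\ U r w = perm_matrix R (sg w r).
  by rewrite ffunE; exact: (projT2 (cid (sgP w r))).
have setE f : [set w | sg w = f] = \bigcap_(r in [set` [set: 'I_s]%SET]) (U r @^-1` [set perm_matrix R (f r)]).
  apply/seteqP; split=> [w /= <- r _ /=|w H]; first by have [] := sgE w r.
  apply/ffunP => r; apply: (@perm_matrix_inj R); have [_ <-] := sgE w r.
  by apply: (H r); rewrite /= finset.inE.
exists sg; split.
- by move=> w r; have [] := sgE w r.
- by move=> w; rewrite finset.inE; apply/forallP => r; have [] := sgE w r.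
- move=> f; rewrite setE; apply: fin_bigcap_measurable => [|r _].
    exact: finite_finset.
  have [mU _] := U_perm r; rewrite -[X in measurable X]setTI; apply: mU => //.
  exact: measurable_mx1.
- move=> f; rewrite finset.inE => /forallP fS; rewrite setE U_indep; last first.
    by move=> r; exact: measurable_mx1.
  rewrite (eq_bigr (fun r => (#|S r|%:R^-1)%:E)); last first.
    by move=> r _; have [_ -> //] := U_unif r; exact: fS.
  rewrite card_perm_family natr_prod -prodfV -prodEFin.
  by apply: eq_bigl => r; rewrite finset.inE.
Qed.
End Law.

Section FiniteLaw.
Local Open Scope classical_set_scope.
Variables (R : realType) (d : measure_display) (Omega : measurableType d).
Variables (P : probability Omega R) (F : finType) (Q : {set F}) (sg : Omega -> F).
Hypothesis sgQ : forall w, sg w \in Q.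
Hypothesis sg_meas : forall f, measurable [set w | sg w = f].
Hypothesis sg_law : forall f, f \in Q -> P [set w | sg w = f] = (#|Q|%:R^-1)%:E.

Lemma measurable_finite_obs (g : F -> R) : measurable_fun setT ((fun w => (g (sg w))%:E) : Omega -> \bar R).
Proof.
move=> _ Y mY; rewrite setTI.
rewrite (_ : _ @^-1` Y = \bigcup_(f in [set f | Y (g f)%:E]) [set w | sg w = f]); last first.
  by apply/seteqP; split=> [w /= Yw|w [f /= Yf E]]; [exists (sg w)|rewrite /= E].
by apply: fin_bigcup_measurable => // ; exact: finite_finset.
Qed.

Lemma integral_finite_obs (g : F -> R) : (forall f, 0 <= g f) ->
  (\int[P]_w (g (sg w))%:E)%E = ((\sum_(f in Q) g f) / #|Q|%:R)%:E.
Proof.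
move=> g0.
have gE w : (g (sg w))%:E = (\sum_(f <- index_enum F) (g f)%:E * (\1_[set w | sg w = f] w)%:E)%E.
  rewrite (bigD1 (sg w)) //= indicE mem_set // mule1 big1 ?adde0 // => f fw.
  by rewrite indicE memNset ?mule0 // => /= E; rewrite E eqxx in fw.
under eq_integral do rewrite gE.
rewrite ge0_integral_sum //=; first last.
- by move=> f w _; rewrite mule_ge0 ?lee_fin.
- move=> f; apply: measurable_funeM; apply/measurable_EFinP; exact: measurable_indic.
have IE f : (\int[P]_w ((g f)%:E * (\1_[set w | sg w = f] w)%:E))%E =
    (if f \in Q then g f / #|Q|%:R else 0)%:E.
  rewrite ge0_integralZl_EFin //=; last first.
    by apply/measurable_EFinP; exact: measurable_indic.
  rewrite integral_indic // setIT; case: ifP => fQ; first by rewrite EFinM -(sg_law fQ).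
  rewrite (_ : [set w | sg w = f] = set0) ?measure0 ?mule0 //.
  by rewrite -subset0 => w /= E; rewrite -E sgQ in fQ.
under eq_bigr do rewrite IE.
by rewrite sumEFin mulr_suml [in RHS]big_mkcond.
Qed.
End FiniteLaw.

(** * From mean squares to limits *)

Section Limits.
Local Open Scope classical_set_scope.
Variables (R : realType) (K : finType) (N : nat -> nat).
Variable S : forall k, K -> {set 'S_(N k)}.
Hypothesis S_neq0 : forall k r, S k r != finset.set0.
Hypothesis N_gt0 : forall k, (0 < N k)%N.
Variable X : observable K N.
Arguments X : clear implicits.

Lemma cvg_real_complex (a : nat -> R) (l : R) : a @ \oo --> l ->
  ((fun k => (a k)%:C%C) : nat -> R[i]^o) @ \oo --> (l%:C%C : R[i]^o).
Proof.
move=> /cvgrPdist_lt al; apply/cvgrPdist_lt => -[e b] /=.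
rewrite ltcE /= => /andP[/eqP b0 e0]; near=> k.
rewrite -rmorphB normc_def ltcE /= b0 eqxx /= expr0n /= addr0 sqrtr_sqr.
by near: k; exact: al.
Unshelve. all: by end_near. Qed.

Definition mean_density k : R :=
  (\sum_(f in perm_family (S k)) (X k f)%:R / (N k)%:R) / #|perm_family (S k)|%:R.

Lemma mean_sqrE k : mean_sqr R S X k =
  (\sum_(f in perm_family (S k)) ((X k f)%:R / (N k)%:R) ^+ 2) / #|perm_family (S k)|%:R.
Proof.
rewrite /mean_sqr natr_sum natrM invfM mulrA mulrAC; congr (_ / _).
by rewrite mulr_suml; apply: eq_bigr => f _; rewrite expr_div_n !natrX.
Qed.

(** Each proportion x satisfies x <= e/2 + x^2 / (e/2). *)
Lemma mean_density_cvg0 : vanishing (mean_sqr R S X) -> mean_density @ \oo --> (0 : R).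
Proof.
move=> X0; apply/cvgr0Pnorm_le => e e0.
have e2 : 0 < e / 2 by rewrite divr_gt0.
have := X0; move=> /cvgr0Pnorm_le /(_ ((e / 2) ^+ 2)).
rewrite exprn_gt0 // => /(_ isT) Xe; near=> k.
have P0 : 0 < #|perm_family (S k)|%:R :> R by rewrite ltr0n; exact: perm_family_gt0.
rewrite ger0_norm; last by rewrite divr_ge0 // sumr_ge0 // => f _; rewrite divr_ge0.
have Xk : mean_sqr R S X k <= (e / 2) ^+ 2.
  by apply: le_trans (ler_norm _) _; near: k.
apply: (@le_trans _ _ (e / 2 + mean_sqr R S X k / (e / 2))); last first.
  have : mean_sqr R S X k / (e / 2) <= e / 2 by rewrite ler_pdivrMr // -expr2.
  by lra.
rewrite mean_sqrE /mean_density ler_pdivrMr // mulrDl [X in _ + X]mulrAC divfK ?gt_eqF //.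
have -> : e / 2 * #|perm_family (S k)|%:R = \sum_(f in perm_family (S k)) e / 2.
  by rewrite sumr_const mulr_natr.
rewrite [X in _ + X]mulr_suml -big_split /=; apply: ler_sum => f _.
move: (_ / _) => x; rewrite -(ler_pM2r e2) mulrDl divfK ?gt_eqF //.
by nra.
Unshelve. all: by end_near. Qed.

Variables (d : measure_display) (Omega : measurableType d) (P : probability Omega R).
Variable sg : forall k, Omega -> {ffun K -> 'S_(N k)}.
Hypothesis sgS : forall k w, sg k w \in perm_family (S k).
Hypothesis sg_meas : forall k f, measurable [set w | sg k w = f].
Hypothesis sg_law : forall k f, f \in perm_family (S k) ->
  P [set w | sg k w = f] = (#|perm_family (S k)|%:R^-1)%:E.

(** By monotone convergence the series of the squared proportions has a finite
    mean, so it converges almost surely and its terms tend to 0. *)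
Lemma density_cvg0_ae : summable_seq (mean_sqr R S X) ->
  {ae P, forall w, (fun k => (X k (sg k w))%:R / (N k)%:R) @ \oo --> (0 : R)}.
Proof.
move=> [M XM]; pose x k w : R := (X k (sg k w))%:R / (N k)%:R.
pose y k w : \bar R := (x k w ^+ 2)%:E.
have y0 k w : (0 <= y k w)%E by rewrite lee_fin sqr_ge0.
have my k : measurable_fun setT (y k).
  exact: (measurable_finite_obs (@sg_meas k) (fun f => ((X k f)%:R / (N k)%:R) ^+ 2)).
have Iy k : (\int[P]_w y k w)%E = (mean_sqr R S X k)%:E.
  rewrite mean_sqrE; apply: (integral_finite_obs (@sgS k) (@sg_meas k) (@sg_law k)
     (g := fun f => ((X k f)%:R / (N k)%:R) ^+ 2)) => f; exact: sqr_ge0.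
pose Y w : \bar R := (\sum_(0 <= k <oo) y k w)%E.
have Y0 w : (0 <= Y w)%E by apply: nneseries_ge0 => k _ _; exact: y0.
have IY : (\int[P]_w Y w < +oo)%E.
  rewrite integral_nneseries //.
  apply: (@le_lt_trans _ _ M%:E); last exact: ltry.
  apply: lime_le; first by apply: is_cvg_nneseries => k _ _; rewrite integral_ge0.
  near=> n; rewrite (eq_bigr (fun k => (mean_sqr R S X k)%:E)) => [|k _]; last exact: Iy.
  rewrite sumEFin lee_fin big_mkord; apply: le_trans (XM n); apply: ler_sum => k _.
  exact: ler_norm.
have intY : P.-integrable setT Y.
  apply/integrableP; split; first exact: ge0_emeasurable_sum.
  by under eq_integral do rewrite gee0_abs //.
have := integrable_ae measurableT intY; apply: filterS => w /(_ I) Yfin.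
have sumx n : \sum_(k < n) x k w ^+ 2 <= fine (Y w).
  rewrite -lee_fin fineK // -sumEFin -(big_mkord xpredT (fun k => y k w)).
  by apply: nneseries_lim_ge => k _.
have cx : cvgn (series (fun k => x k w ^+ 2)).
  apply: nondecreasing_is_cvgn.
    by apply: nondecreasing_series => k _ _; exact: sqr_ge0.
  by exists (fine (Y w)) => _ [n _ <-]; rewrite /series /= big_mkord.
have /cvgr0Pnorm_lt x20 := cvg_series_cvg_0 cx.
apply/cvgr0Pnorm_lt => e e0; have := x20 (e ^+ 2); rewrite exprn_gt0 // => /(_ isT).
apply: filterS => k; rewrite ger0_norm ?sqr_ge0 // -real_normK ?num_real //.
by rewrite ltr_pXn2r ?nnegrE // ltW.
Unshelve. all: by end_near. Qed.
End Limits.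

(** * Convergence of the random permutation matrices *)

Lemma nfix_nmoved (T : finType) (s : {perm T}) : (nfix s + nmoved s = #|T|)%N.
Proof.
rewrite /nfix /nmoved -(cardC [pred x | s x == x]); congr (_ + _)%N.
  by apply: eq_card => x; rewrite finset.inE.
by apply: eq_card => x; rewrite finset.inE.
Qed.

Lemma nfix_density (R : realType) (n : nat) (s : 'S_n) : (0 < n)%N ->
  (nfix s)%:R / n%:R = 1 - (nmoved s)%:R / n%:R :> R.
Proof.
move=> n0; have nn : n%:R != 0 :> R by rewrite pnatr_eq0 -lt0n.
apply: (addIr ((nmoved s)%:R / n%:R)).
by rewrite subrK -mulrDl -natrD nfix_nmoved card_ord divff.
Qed.

Section RandomPermutations.
Local Open Scope classical_set_scope.
Variables (R : realType) (s : nat) (A : 'I_s -> set nat).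
Variables (Alg : starAlgType R) (phi : {scalar Alg}) (u : 'I_s -> Alg) (N : nat -> nat).
Variables (d : measure_display) (Omega : measurableType d) (P : probability Omega R).
Variable U : forall k : nat, 'I_s -> Omega -> borel_mx R (N k).
Hypothesis A_neq0 : forall r, A r !=set0.
Hypothesis A_fin_or_summable : forall r, finite_set (A r) \/
     (\esum_(j in [set j | (0 < j)%N] `\` A r) (j%:R^-1 : R)%:E < +oo)%E.
Hypothesis phi_state : is_state phi.
Hypothesis u_free : star_free phi u.
Hypothesis u_haar : forall r, haar_unitary phi (sup_nat (A r)) (u r).
Hypothesis N_gt0 : forall k, (0 < N k)%N.
Hypothesis N_incr : {homo N : k l / (k < l)%N}.
Hypothesis S_neq0 : forall k r, perms_with_cycles (N k) (A r) != finset.set0.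
Hypothesis U_perm : forall k r, random_perm_matrix (U k r).
Hypothesis U_unif : forall k r, uniform_on P (perms_with_cycles (N k) (A r)) (U k r).
Hypothesis U_indep : forall k, independent_family P (U k).

Let S k r := perms_with_cycles (N k) (A r).

Lemma matrix_size_gt k : (k < N k)%N.
Proof. by elim: k => [//|k IH]; apply: leq_trans (N_incr (ltnSn k)); rewrite ltnS. Qed.

Lemma A_tail r : finite_set (A r) \/
  exists K, forall m, \sum_(K <= j < m | j \notin A r) (j%:R^-1 : R) <= 2^-1.
Proof. by have [Afin|/esum_tail] := A_fin_or_summable r; [left | right]. Qed.

Lemma off_length_vanishing r e : finite_set (A r) -> sup_nat (A r) = Some e ->
  l2_small S (@vanishing R) (fun k f => off_length_points e (f r)).
Proof.
move=> Afin Ee; have [e' [Ee' Ae emax]] := sup_nat_finite (A_neq0 r) Afin.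
move: Ae emax; have -> : e' = e by move: Ee'; rewrite Ee => -[].
move=> Ae emax; apply: (off_length_mean_cvg S_neq0 matrix_size_gt (A := fun n => n \in A r)).
- by move=> k; exact: perms_with_cyclesE.
- exact/mem_set.
- by move=> j /set_mem; exact: emax.
Qed.

(** If m is the only allowed length, no point is off the m-cycles. *)
Lemma off_length_summable r e : (exists m, A r = [set m]) \/ infinite_set (A r) ->
  finite_set (A r) -> sup_nat (A r) = Some e ->
  l2_small S (@summable_seq R) (fun k f => off_length_points e (f r)).
Proof.
move=> [[m Am]|//] Afin Ee; have [e' [Ee' Ae _]] := sup_nat_finite (A_neq0 r) Afin.
move: Ae; have -> : e' = e by move: Ee'; rewrite Ee => -[].
move=> Ae; apply: (marginal_l2_small matrix_size_gt S_neq0 (@summable_le R) (@summable_inv_sqr R N matrix_size_gt)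
  (F := fun k t => off_length_points e t) (C := 0)) => k.
rewrite big1 // => t; rewrite perms_with_cyclesE finset.inE => /andP[_ /forall_inP tA].
rewrite /off_length_points eq_card0 // => x; rewrite finset.inE; apply/negbTE; rewrite negbK.
have /set_mem : #|porbit t x| \in A r by apply: tA; rewrite finset.inE.
by move: Ae; rewrite Am /= => -> ->.
Qed.

Lemma random_permutations : exists sg : forall k, Omega -> {ffun 'I_s -> 'S_(N k)},
  [/\ forall k w r, U k r w = perm_matrix R (sg k w r),
      forall k w, sg k w \in perm_family (S k),
      forall k f, measurable [set w | sg k w = f] &
      forall k f, f \in perm_family (S k) ->
        P [set w | sg k w = f] = (#|perm_family (S k)|%:R^-1)%:E].
Proof.
have law k := permutation_law (@U_perm k) (@U_unif k) (@U_indep k).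
exists (fun k => projT1 (cid (law k))).
by split=> k; case: (projT2 (cid (law k))).
Qed.

Lemma complex_expectation_real k (sg : Omega -> {ffun 'I_s -> 'S_(N k)})
    (g : {ffun 'I_s -> 'S_(N k)} -> R) :
  (forall w, sg w \in perm_family (S k)) ->
  (forall f, measurable [set w | sg w = f]) ->
  (forall f, f \in perm_family (S k) ->
     P [set w | sg w = f] = (#|perm_family (S k)|%:R^-1)%:E) ->
  (forall f, 0 <= g f) ->
  complex_expectation P (fun w => (g (sg w))%:C%C) =
    ((\sum_(f in perm_family (S k)) g f) / #|perm_family (S k)|%:R)%:C%C.
Proof.
move=> sgS mS lS g0; rewrite /complex_expectation /= unlock /=.
by rewrite (integral_finite_obs sgS mS lS g0) /= integral0.
Qed.

Lemma cvg_expected_moments : cvg_star_distribution P U phi u.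
Proof.
have [sg [sgE sgS sg_meas sg_law]] := random_permutations.
move=> n r e _; rewrite star_moment_word; set wd := letter_word r e.
have momE k : complex_expectation P (fun w => matrix_moment (fun q => U k q w) r e) =
    (mean_density R S (fun k f => nfix (perm_word f wd)) k)%:C%C.
  rewrite -(complex_expectation_real (g := fun f => (nfix (perm_word f wd))%:R / (N k)%:R)
    (sgS k) (sg_meas k) (sg_law k)); last by move=> f; rewrite divr_ge0.
  congr complex_expectation; apply/funext => w.
  exact: (matrix_moment_word r e (sgE k w)).
under eq_fun do rewrite momE.
have [phi1 _] := phi_state.
have [[-> /mean_density_cvg0]|[-> /mean_density_cvg0]] :=
  cycle_word_dichotomy A_neq0 A_tail phi1 u_free u_haar matrix_size_gt S_neq0 (@vanishingD R)
    (@vanishing_le R) (@vanishing_inv_sqr R N matrix_size_gt) off_length_vanishing wd.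
  move=> H; rewrite -[1]/(1%:C%C : R[i]); apply: cvg_real_complex.
  rewrite (_ : mean_density R S _ =
      fun k => 1 - mean_density R S (fun k f => nmoved (perm_word f wd)) k).
    by rewrite -[X in _ --> X]subr0; apply: cvgB; [exact: cvg_cst | exact: H].
  apply/funext => k; rewrite /mean_density (eq_bigr _ (fun f _ => nfix_density R _ (N_gt0 k))).
  rewrite big_split /= sumrN sumr_const mulrBl divff // pnatr_eq0 -lt0n.
  exact: perm_family_gt0.
by move=> H; rewrite -[0]/(0%:C%C : R[i]); apply: cvg_real_complex; exact: H.
Qed.

Lemma cvg_moments_ae :
  (forall r, (exists m, A r = [set m]) \/ infinite_set (A r)) ->
  cvg_star_distribution_as P U phi u.
Proof.
move=> A_single.
have [sg [sgE sgS sg_meas sg_law]] := random_permutations.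
move=> n r e _; rewrite star_moment_word; set wd := letter_word r e.
pose x k w : R := (nfix (perm_word (sg k w) wd))%:R / (N k)%:R.
have momE k w : matrix_moment (fun q => U k q w) r e = (x k w)%:C%C.
  exact: (matrix_moment_word r e (sgE k w)).
have [phi1 _] := phi_state.
have [[-> sX]|[-> sX]] :=
  cycle_word_dichotomy A_neq0 A_tail phi1 u_free u_haar matrix_size_gt S_neq0 (@summableD R)
    (@summable_le R) (@summable_inv_sqr R N matrix_size_gt)
    (fun r e => @off_length_summable r e (A_single r)) wd;
  have := density_cvg0_ae sgS sg_meas sg_law sX; apply: filterS => w Xw.
  under eq_fun do rewrite momE.
  rewrite -[1]/(1%:C%C : R[i]); apply: cvg_real_complex.
  have -> : x^~ w = fun k => 1 - (nmoved (perm_word (sg k w) wd))%:R / (N k)%:R.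
    by apply/funext => k; exact: nfix_density.
  by rewrite -[X in _ --> X]subr0; apply: cvgB; [exact: cvg_cst | exact: Xw].
under eq_fun do rewrite momE.
by rewrite -[0]/(0%:C%C : R[i]); apply: cvg_real_complex.
Qed.
End RandomPermutations.

Local Open Scope classical_set_scope.

Theorem theorem4p6 (R : realType) (s : nat) (A : 'I_s -> set nat)
    (Alg : starAlgType R) (phi : {scalar Alg}) (u : 'I_s -> Alg)
    (N : nat -> nat)
    (d : measure_display) (Omega : measurableType d) (P : probability Omega R)
    (U : forall k : nat, 'I_s -> Omega -> borel_mx R (N k)) :
  (0 < s)%N ->
  (forall r, A r !=set0) ->
  (forall r j, A r j -> (0 < j)%N) ->
  (forall r, finite_set (A r) \/
     (\esum_(j in [set j | (0 < j)%N] `\` A r) (j%:R^-1 : R)%:E < +oo)%E) ->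
  is_state phi ->
  star_free phi u ->
  (forall r, haar_unitary phi (sup_nat (A r)) (u r)) ->
  (forall k, (0 < N k)%N) ->
  {homo N : k l / (k < l)%N} ->
  (forall k r, perms_with_cycles (N k) (A r) != finset.set0) ->
  (forall k r, random_perm_matrix (U k r)) ->
  (forall k r, uniform_on P (perms_with_cycles (N k) (A r)) (U k r)) ->
  (forall k, independent_family P (U k)) ->
  cvg_star_distribution P U phi u /\
  ((forall r, (exists m, A r = [set m]) \/ infinite_set (A r)) ->
   cvg_star_distribution_as P U phi u).
Proof.
move=> _ A0 _ Afs phi_state u_free u_haar N0 N_incr S0 U_perm U_unif U_indep; split.
  exact: (cvg_expected_moments A0).
exact: (cvg_moments_ae A0).
Qed.
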